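(* Let $\mathcal M$ be a model of $\mathsf{WKL}_0+\mathsf{B}\Sigma^0_2$. If $G$ is generic for $F_\sigma$-Mathias forcing over $\mathcal M$, then $\mathcal M[G]\models\mathsf{RCA}_0$.
   Context: Conventions. $\mathcal M$ is a (possibly nonstandard) model of second-order arithmetic with first-order part $\mathbb N$. The notions below, up to the definition of genericity, are interpreted inside $\mathcal M$: sets, functions, sequences and reals belong to $\mathcal M$ and ''finite'' means finite in the sense of $\mathcal M$; ''class'' means a collection of second-order objects. $\mathcal P_{<\infty}(\mathbb N)$ is the set of (codes for) finite sets, $2^{<\infty}$ the set of finite binary strings, $\chi_X$ the characteristic function of $X$. Submeasures. A submeasure is a function $\mu:\mathcal P_{<\infty}(\mathbb N)\to\mathbb R$ with $\mu(\varnothing)=0$ and $\max(\mu(x),\mu(y))\le\mu(x\cup y)\le\mu(x)+\mu(y)$ for all finite $x,y$. For $X\subseteq\mathbb N$: $\mu(X)<\infty$ means $\exists m\,\forall n\,\mu(X\cap\{0,\dots,n-1\})\le m$; otherwise $\mu(X)=\infty$. Submeasures are ordered pointwise on finite sets. Forcing. An $F_\sigma$-Mathias condition is a triple $(a,A,\mu)$ with $a$ finite, $a\subseteq A\subseteq\mathbb N$, and $\mu$ a submeasure with $\mu(A)=\infty$. Extension: $(b,B,\nu)\le(a,A,\mu)$ iff $a\subseteq b\subseteq A$, $B\subseteq A$ and $\nu\le\mu$. Put $[a,A,\mu]=\{B\subseteq\mathbb N: a\subseteq B\subseteq A,\ \mu(B)=\infty\}$. Names. A partial $k$-ary name is a $\Sigma^0_1$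 (parameters allowed) set $F\subseteq2^{<\infty}\times\mathbb N^{k+1}$ such that $(\tau,\bar x,y)\in F$, $\tau\subseteq\tau'$ imply $(\tau',\bar x,y)\in F$, and $(\tau,\bar x,y),(\tau,\bar x,y')\in F$ imply $y=y'$. Its domain is $\mathrm{dom}(F)=\{X\subseteq\mathbb N:\forall\bar x\,\exists\tau,y\,(\tau\subseteq\chi_X\wedge(\tau,\bar x,y)\in F)\}$. $F$ is $(a,A,\mu)$-local if $[b,B,\nu]\cap\mathrm{dom}(F)\ne\varnothing$ for every $(b,B,\nu)\le(a,A,\mu)$. Generic extension. Let $\mathcal G$ be a generic filter over $\mathcal M$: a filter of $F_\sigma$-Mathias conditions of $\mathcal M$ meeting every dense class of conditions that is definable over $\mathcal M$ with parameters. The associated generic real is $G=\bigcup\{a:(a,A,\mu)\in\mathcal G\}$, and ''$G$ is generic for $F_\sigma$-Mathias forcing'' means that it arises in this way. A condition is compatible with $G$ if it belongs to $\mathcal G$. A name is $G$-local if it is $(a,A,\mu)$-local for some condition compatible with $G$. For a $G$-local $k$-ary name $F$, $F^G:\mathbb N^k\to\mathbb N$ is the function with $F^G(\bar x)=y\iff\exists n\,(G{\upharpoonright}n,\bar x,y)\in F$ (here $G{\upharpoonright}n$ is the length-$n$ initial segment of the characteristic function of $G$). $\mathcal M[G]$ has the same first-order part $\mathbb N$ (with the same arithmetic) as $\mathcal M$ and its $k$-ary functions are the $F^G$ for $G$-local $k$-ary names $F$; as a structure for second-order arithmetic, its sets are the subsets of $\mathbb N$ whose characteristic function is a unary function of $\mathcal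 M[G]$. *)

(* Defs.v *)
From mathcomp Require Import all_boot.
Set Implicit Arguments.
Unset Strict Implicit.
Unset Printing Implicit Defensive.

(* Structures for second-order arithmetic, Henkin semantics: the second-order
   part is an arbitrary collection of subsets of the first-order part. *)
Record L2structure := L2Structure {
  num : Type;
  zero : num;
  one : num;
  add : num -> num -> num;
  mul : num -> num -> num;
  lt : num -> num -> Prop;
  sets : (num -> Prop) -> Prop
}.
Arguments zero {_}.
Arguments one {_}.

Declare Scope l2_scope.
Delimit Scope l2_scope with L2.
Notation "x + y" := (add x y) : l2_scope.
Notation "x * y" := (mul x y) : l2_scope.
Notation "x < y" := (lt x y) : l2_scope.
Notation "0" := zero : l2_scope.
Notation "1" := one : l2_scope.
Local Open Scope l2_scope.

(* Number variables and set variables are separate families of de Bruijn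
   indices. *)
Inductive term :=
  | TVar of nat
  | TZero
  | TOne
  | TAdd of term & term
  | TMul of term & term.

(* The bound [t] of [BAll t phi] and [BEx t phi] is read outside the scope of
   the bound variable. *)
Inductive formula :=
  | Eq of term & term
  | Lt of term & term
  | In of term & nat
  | Not of formula
  | And of formula & formula
  | Or of formula & formula
  | Imp of formula & formula
  | BAll of term & formula
  | BEx of term & formula
  | All of formula
  | Ex of formula
  | SAll of formula
  | SEx of formula.

Definition scons (T : Type) (x : T) (e : nat -> T) : nat -> T :=
  fun i => if i is j.+1 then e j else x.

Fixpoint eval (M : L2structure) (e : nat -> num M) (t : term) : num M :=
  match t with
  | TVar i => e i
  | TZero => 0
  | TOne => 1
  | TAdd s t => eval e s + eval e t
  | TMul s t => eval e s * eval e t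
  end.

Fixpoint sat (M : L2structure) (e : nat -> num M) (E : nat -> num M -> Prop)
    (phi : formula) : Prop :=
  match phi with
  | Eq s t => eval e s = eval e t
  | Lt s t => eval e s < eval e t
  | In t i => E i (eval e t)
  | Not p => ~ sat e E p
  | And p q => sat e E p /\ sat e E q
  | Or p q => sat e E p \/ sat e E q
  | Imp p q => sat e E p -> sat e E q
  | BAll t p => forall x, x < eval e t -> sat (scons x e) E p
  | BEx t p => exists x, x < eval e t /\ sat (scons x e) E p
  | All p => forall x, sat (scons x e) E p
  | Ex p => exists x, sat (scons x e) E p
  | SAll p => forall X, sets X -> sat e (scons X E) p
  | SEx p => exists X, sets X /\ sat e (scons X E) p
  end.

Definition set_env (M : L2structure) (E : nat -> num M -> Prop) : Prop :=
  forall i, sets (E i).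

Fixpoint Delta00 (phi : formula) : Prop :=
  match phi with
  | Eq _ _ | Lt _ _ | In _ _ => True
  | Not p | BAll _ p | BEx _ p => Delta00 p
  | And p q | Or p q | Imp p q => Delta00 p /\ Delta00 q
  | All _ | Ex _ | SAll _ | SEx _ => False
  end.

Definition Sigma01 (phi : formula) : Prop :=
  exists2 theta, Delta00 theta & phi = Ex theta.
Definition Pi01 (phi : formula) : Prop :=
  exists2 theta, Delta00 theta & phi = All theta.
Definition Sigma02 (phi : formula) : Prop :=
  exists2 psi, Pi01 psi & phi = Ex psi.

Definition basic_axioms (M : L2structure) : Prop :=
  (forall n : num M, n + 1 <> 0) /\
  (forall m n : num M, m + 1 = n + 1 -> m = n) /\
  (forall m : num M, m + 0 = m) /\
  (forall m n : num M, m + (n + 1) = (m + n) + 1) /\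
  (forall m : num M, m * 0 = 0) /\
  (forall m n : num M, m * (n + 1) = m * n + m) /\
  (forall m : num M, ~ m < 0) /\
  (forall m n : num M, m < n + 1 <-> m < n \/ m = n).

Definition Sigma01_induction (M : L2structure) : Prop :=
  forall (phi : formula) (e : nat -> num M) (E : nat -> num M -> Prop),
    Sigma01 phi -> set_env E ->
    sat (scons 0 e) E phi ->
    (forall n, sat (scons n e) E phi -> sat (scons (n + 1) e) E phi) ->
    forall n, sat (scons n e) E phi.

Definition Delta01_comprehension (M : L2structure) : Prop :=
  forall (phi psi : formula) (e : nat -> num M) (E : nat -> num M -> Prop),
    Sigma01 phi -> Pi01 psi -> set_env E ->
    (forall n, sat (scons n e) E phi <-> sat (scons n e) E psi) ->
    exists X, sets X /\ forall n, X n <-> sat (scons n e) E phi.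

Definition RCA0 (M : L2structure) : Prop :=
  [/\ basic_axioms M, Sigma01_induction M & Delta01_comprehension M].

(* In [phi], variable 0 is y and variable 1 is x. *)
Definition BSigma02 (M : L2structure) : Prop :=
  forall (phi : formula) (e : nat -> num M) (E : nat -> num M -> Prop),
    Sigma02 phi -> set_env E ->
    forall n,
      (forall x, x < n -> exists y, sat (scons y (scons x e)) E phi) ->
      exists m, forall x, x < n ->
        exists y, y < m /\ sat (scons y (scons x e)) E phi.

Definition le (M : L2structure) (x y : num M) : Prop := x < y \/ x = y.
Notation "x <= y" := (le x y) : l2_scope.

Definition pair (M : L2structure) (i j : num M) : num M :=
  (i + j) * (i + j) + i.

(* Every number c denotes a finite set via the divisibility coding;
   the code of a finite set is the least number denoting it. *)
Definition mem (M : L2structure) (i c : num M) : Prop :=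
  exists k m n, c = pair k (pair m n) /\ i < k /\
    exists q, n = q * (m * (i + 1) + 1).

Definition is_fin (M : L2structure) (c : num M) : Prop :=
  forall c', c' < c -> ~ (forall i, mem i c' <-> mem i c).

Definition codes (M : L2structure) (c : num M) (P : num M -> Prop) : Prop :=
  is_fin c /\ forall i, mem i c <-> P i.

(* A finite binary string of length l is coded as (l, s), where s is the finite
   set of positions < l carrying the bit 1. *)
Definition is_string (M : L2structure) (t : num M) : Prop :=
  exists l s, t = pair l s /\ is_fin s /\ forall i, mem i s -> i < l.

Definition string_ext (M : L2structure) (t t' : num M) : Prop :=
  is_string t /\ is_string t' /\
  exists l s l' s', t = pair l s /\ t' = pair l' s' /\ l <= l' /\
    forall i, i < l -> (mem i s <-> mem i s').

(* t is the initial segment of length n of the characteristic function of X. *)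
Definition is_restriction (M : L2structure) (X : num M -> Prop) (n t : num M) :=
  exists s, t = pair n s /\ codes s (fun i => X i /\ i < n).

Definition initial_segment (M : L2structure) (t : num M) (X : num M -> Prop) :=
  exists n, is_restriction X n t.

Definition is_tree (M : L2structure) (T : num M -> Prop) : Prop :=
  (forall t, T t -> is_string t) /\
  (forall t t', T t' -> string_ext t t' -> T t).

Definition infinite (M : L2structure) (X : num M -> Prop) : Prop :=
  forall k, exists n, k <= n /\ X n.

Definition weak_koenig (M : L2structure) : Prop :=
  forall T : num M -> Prop, sets T -> is_tree T -> infinite T ->
    exists X, sets X /\ forall n, exists t, is_restriction X n t /\ T t.

Definition WKL0 (M : L2structure) : Prop := RCA0 M /\ weak_koenig M.

(* [QRat p n d] is the rational (p - n) / (d + 1). *)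
Record qrat (M : L2structure) := QRat { qp : num M; qn : num M; qd : num M }.

Definition qcode (M : L2structure) (q : qrat M) : num M :=
  pair (pair (qp q) (qn q)) (qd q).

Definition qle (M : L2structure) (q r : qrat M) : Prop :=
  qp q * (qd r + 1) + qn r * (qd q + 1) <=
  qp r * (qd q + 1) + qn q * (qd r + 1).

Definition qadd (M : L2structure) (q r : qrat M) : qrat M :=
  QRat (qp q * (qd r + 1) + qp r * (qd q + 1))
       (qn q * (qd r + 1) + qn r * (qd q + 1))
       (qd q * qd r + qd q + qd r).

(* m / (k + 1) *)
Definition qfrac (M : L2structure) (m k : num M) : qrat M := QRat m 0 k.

Definition qclose (M : L2structure) (q r eps : qrat M) : Prop :=
  qle q (qadd r eps) /\ qle r (qadd q eps).

(* Reals are Cauchy sequences of rationals with the modulus 1/(k+1), given by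
   their graphs; equality of reals is mutual [rle]. *)
Definition is_real (M : L2structure) (x : num M -> qrat M -> Prop) : Prop :=
  (forall k, exists! q, x k q) /\
  (forall k l q r, k <= l -> x k q -> x l r -> qclose q r (qfrac 1 k)).

Definition rle (M : L2structure) (x y : num M -> qrat M -> Prop) : Prop :=
  forall k q r, x k q -> y k r -> qle q (qadd r (qfrac (1 + 1) k)).

(* Passing to the index 2k+1 keeps the modulus of the sum at 1/(k+1). *)
Definition radd (M : L2structure) (x y : num M -> qrat M -> Prop) :
    num M -> qrat M -> Prop :=
  fun k s => exists q r, x (k + k + 1) q /\ y (k + k + 1) r /\ s = qadd q r.

Definition rnat (M : L2structure) (m : num M) : num M -> qrat M -> Prop :=
  fun _ q => q = qfrac m 0.

(* A function from finite sets to reals is coded by a set U of codes of triples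
   (x, k, q): q is the k-th rational approximation to the value at x. Only the
   triples whose first component is the code of a finite set matter. *)
Definition value (M : L2structure) (U : num M -> Prop) (x : num M) :
    num M -> qrat M -> Prop :=
  fun k q => U (pair (pair x k) (qcode q)).

Definition submeasure (M : L2structure) (U : num M -> Prop) : Prop :=
  [/\ forall x, is_fin x -> is_real (value U x),
      forall x, codes x (fun _ => False) ->
        rle (value U x) (rnat 0) /\ rle (rnat 0) (value U x),
      forall x y z, is_fin x -> is_fin y -> codes z (fun i => mem i x \/ mem i y) ->
        rle (value U x) (value U z) /\ rle (value U y) (value U z)
    & forall x y z, is_fin x -> is_fin y -> codes z (fun i => mem i x \/ mem i y) ->
        rle (value U z) (radd (value U x) (value U y))].

Definition finite_measure (M : L2structure) (U X : num M -> Prop) : Prop :=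
  exists m, forall n c, codes c (fun i => X i /\ i < n) ->
    rle (value U c) (rnat m).

Definition infinite_measure (M : L2structure) (U X : num M -> Prop) : Prop :=
  ~ finite_measure U X.

Definition submeasure_le (M : L2structure) (V U : num M -> Prop) : Prop :=
  forall x, is_fin x -> rle (value V x) (value U x).

Record triple (M : L2structure) := Triple {
  stem : num M;
  reservoir : num M -> Prop;
  measure : num M -> Prop
}.

Definition condition (M : L2structure) (p : triple M) : Prop :=
  [/\ is_fin (stem p), sets (reservoir p),
      forall i, mem i (stem p) -> reservoir p i,
      sets (measure p) /\ submeasure (measure p)
    & infinite_measure (measure p) (reservoir p)].

Definition extends (M : L2structure) (q p : triple M) : Prop :=
  [/\ forall i, mem i (stem p) -> mem i (stem q),
      forall i, mem i (stem q) -> reservoir p i,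
      forall i, reservoir q i -> reservoir p i
    & submeasure_le (measure q) (measure p)].

Definition neighborhood (M : L2structure) (p : triple M) (X : num M -> Prop) :=
  [/\ sets X, forall i, mem i (stem p) -> X i, forall i, X i -> reservoir p i
    & infinite_measure (measure p) X].

(* F t x y with t a code of a binary string, x a k-tuple and y a number. *)
Definition relation (M : L2structure) (k : nat) : Type :=
  num M -> k.-tuple (num M) -> num M -> Prop.

Definition Sigma01_relation (M : L2structure) (k : nat) (F : relation M k) :=
  exists phi (e : nat -> num M) (E : nat -> num M -> Prop),
    [/\ Sigma01 phi, set_env E
      & forall t (x : k.-tuple (num M)) y,
          F t x y <-> sat (foldr (@scons _) e (t :: rcons x y)) E phi].

Definition partial_name (M : L2structure) (k : nat) (F : relation M k) : Prop :=
  [/\ Sigma01_relation F,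
      forall t x y, F t x y -> is_string t,
      forall t t' x y, F t x y -> string_ext t t' -> F t' x y
    & forall t x y y', F t x y -> F t x y' -> y = y'].

Definition in_dom (M : L2structure) (k : nat) (F : relation M k)
    (X : num M -> Prop) : Prop :=
  sets X /\ forall x, exists t y, initial_segment t X /\ F t x y.

Definition local (M : L2structure) (k : nat) (F : relation M k) (p : triple M) :=
  forall q, condition q -> extends q p ->
    exists X, neighborhood q X /\ in_dom F X.

Definition definable_class (M : L2structure) (D : triple M -> Prop) : Prop :=
  (forall p, D p -> condition p) /\
  exists phi (e : nat -> num M) (E : nat -> num M -> Prop),
    set_env E /\
    forall p, condition p ->
      (D p <-> sat (scons (stem p) e)
                   (scons (reservoir p) (scons (measure p) E)) phi).

Definition dense_class (M : L2structure) (D : triple M -> Prop) : Prop :=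
  forall p, condition p -> exists q, D q /\ extends q p.

Definition is_filter (M : L2structure) (GG : triple M -> Prop) : Prop :=
  [/\ forall p, GG p -> condition p,
      exists p, GG p,
      forall p q, GG p -> condition q -> extends p q -> GG q
    & forall p q, GG p -> GG q -> exists r, [/\ GG r, extends r p & extends r q]].

Definition generic_filter (M : L2structure) (GG : triple M -> Prop) : Prop :=
  is_filter GG /\
  forall D, definable_class D -> dense_class D -> exists p, GG p /\ D p.

Definition generic_real (M : L2structure) (GG : triple M -> Prop) : num M -> Prop :=
  fun i => exists p, GG p /\ mem i (stem p).

(* Locality for a name with respect to the generic real refers to conditions
   compatible with it, i.e. to elements of the generic filter; hence the filter
   is the parameter here and in the generic extension. *)
Definition G_local (M : L2structure) (GG : triple M -> Prop) (k : nat)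
    (F : relation M k) : Prop :=
  exists p, GG p /\ local F p.

Definition eval_name (M : L2structure) (GG : triple M -> Prop) (k : nat)
    (F : relation M k) (x : k.-tuple (num M)) (y : num M) : Prop :=
  exists n t, is_restriction (generic_real GG) n t /\ F t x y.

Definition extension_function (M : L2structure) (GG : triple M -> Prop) (k : nat)
    (f : k.-tuple (num M) -> num M) : Prop :=
  exists F : relation M k,
    [/\ partial_name F, G_local GG F & forall x y, f x = y <-> eval_name GG F x y].

Definition generic_extension (M : L2structure) (GG : triple M -> Prop) : L2structure :=
  {| num := num M;
     zero := 0;
     one := 1;
     add := @add M;
     mul := @mul M;
     lt := @lt M;
     sets := fun X => exists f : 1.-tuple (num M) -> num M,
       extension_function GG f /\
       forall n, (X n -> f [tuple n] = 1) /\ (~ X n -> f [tuple n] = 0) |}.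

(* Main.v *)
(* Only the continuity of names is needed: a Sigma^0_1 statement about G is
   witnessed by an initial segment of G, and any finite string compatible with a
   condition can be absorbed into its stem, keeping the submeasure and a tail of
   the reservoir. A family of Sigma^0_1 open sets (W_n) that is dense below p is
   met, for every q <= p, by some X in [q] lying in the ground model: enumerate
   longer and longer compatible strings meeting W_0, W_1, ... while the measure
   grows. So a Delta^0_1 set of the extension is given by a local name. For
   Sigma^0_1 induction, some string compatible with p meets a maximal set of the
   W_i, i < k; by genericity a condition in the filter decides all of them, and
   the induction takes place in the ground model. *)
From Stdlib Require Import Classical ClassicalEpsilon FunctionalExtensionality.
From Stdlib Require Import Ring.
From mathcomp Require Import all_boot.
Require Import Defs.

Set Implicit Arguments.
Unset Strict Implicit.
Unset Printing Implicit Defensive.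
Local Open Scope l2_scope.

(** The ground model has induction only for Sigma^0_1 predicates, so every construction has to carry
    a proof of its complexity; this is why so much of the proof concerns definability. The obstacle
    in the induction axiom is that the number k of instances to decide may be nonstandard:
    conditions are second-order objects, and a decreasing sequence of k of them cannot be produced
    by recursion inside the model. Strings are numbers, so the choice is moved to them: one string
    meeting a maximal set of the W_i settles all instances by a single restriction. The maximal set
    comes from the least number principle, applied to a product of pairwise coprime moduli in which
    each divisor stands for an instance not yet met. For Delta^0_0 formulas over the extension,
    truth and falsity both have to be approximated by Sigma^0_1 open sets, because membership in a
    set of the extension is seen only through values of a name. The condition at which a formula is
    decided must be the same for all number parameters; otherwise bounded quantifiers of nonstandard
    length could not be handled. *)

Lemma iff_of_eq (P Q : Prop) : P = Q -> (P <-> Q).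
Proof. by move->. Qed.

(** * Renaming of variables and definability with parameters *)

Definition upren (r : nat -> nat) : nat -> nat := scons 0%N (fun i => (r i).+1).

Fixpoint tren (r : nat -> nat) (t : term) : term :=
  match t with
  | TVar i => TVar (r i)
  | TZero => TZero
  | TOne => TOne
  | TAdd s t => TAdd (tren r s) (tren r t)
  | TMul s t => TMul (tren r s) (tren r t)
  end.

Fixpoint fren (r s : nat -> nat) (phi : formula) : formula :=
  match phi with
  | Eq t u => Eq (tren r t) (tren r u)
  | Lt t u => Lt (tren r t) (tren r u)
  | In t i => In (tren r t) (s i)
  | Not p => Not (fren r s p)
  | And p q => And (fren r s p) (fren r s q)
  | Or p q => Or (fren r s p) (fren r s q)
  | Imp p q => Imp (fren r s p) (fren r s q)
  | BAll t p => BAll (tren r t) (fren (upren r) s p)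
  | BEx t p => BEx (tren r t) (fren (upren r) s p)
  | All p => All (fren (upren r) s p)
  | Ex p => Ex (fren (upren r) s p)
  | SAll p => SAll (fren r (upren s) p)
  | SEx p => SEx (fren r (upren s) p)
  end.

Lemma Delta00_fren r s phi : Delta00 phi -> Delta00 (fren r s phi).
Proof.
elim: phi r s => //= [p IHp q IHq|p IHp q IHq|p IHp q IHq|t p IHp|t p IHp] r s.
- by case=> /IHp h /IHq.
- by case=> /IHp h /IHq.
- by case=> /IHp h /IHq.
- exact: IHp.
- exact: IHp.
Qed.

Lemma scons_upren (T : Type) (x : T) e r :
  (fun i => scons x e (upren r i)) = scons x (fun i => e (r i)).
Proof. by apply: functional_extensionality; case. Qed.

Definition mix (T : Type) (e d : nat -> T) (i : nat) : T :=
  if odd i then d i./2 else e i./2.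

Definition class (b : bool) (phi : formula) : Prop := b \/ Delta00 phi.

Lemma class_fren b r s phi : class b phi -> class b (fren r s phi).
Proof. by case=> [?|h]; [left | right; apply: Delta00_fren]. Qed.

Lemma tuple1E (T : Type) (x : 1.-tuple T) : x = [tuple thead x].
Proof. by case/tupleP: x => a t; rewrite theadE (tuple0 t); apply: val_inj. Qed.

Section Structure.
Context (M : L2structure).
Implicit Types (e d : nat -> num M) (E S : nat -> num M -> Prop).

Lemma eval_tren r e t : eval e (tren r t) = eval (fun i => e (r i)) t.
Proof. by elim: t => //= [s -> t ->|s -> t ->]. Qed.

Lemma sat_fren phi r s e E :
  sat e E (fren r s phi) <-> sat (fun i => e (r i)) (fun i => E (s i)) phi.
Proof.
elim: phi r s e E => /=
  [t u|t u|t i|p IHp|p IHp q IHq|p IHp q IHq|p IHp q IHq|t p IHp|t p IHp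
  |p IHp|p IHp|p IHp|p IHp] r s e E; rewrite ?eval_tren //.
- by rewrite IHp.
- by rewrite IHp IHq.
- by rewrite IHp IHq.
- by rewrite IHp IHq.
- by split=> h x /h; rewrite IHp scons_upren.
- by split=> -[x [hx h]]; exists x; split=> //; move: h; rewrite IHp scons_upren.
- by split=> h x; have := h x; rewrite IHp scons_upren.
- by split=> -[x h]; exists x; move: h; rewrite IHp scons_upren.
- by split=> h X /h; rewrite IHp scons_upren.
- by split=> -[X [hX h]]; exists X; split=> //; move: h; rewrite IHp scons_upren.
Qed.

(* Definability with parameters: the even variables of a formula range over the
   context, the odd ones over the parameters. [isF false] is Delta^0_0
   definability, [isF true] definability by an arbitrary formula. [isS1]
   (Sigma^0_1) has no free set variables: closure under bounded quantifiers rests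
   on collection, which holds only for sets of the structure. *)
Definition isTm (t : (nat -> num M) -> num M) : Prop :=
  exists tm d, forall e, t e = eval (mix e d) tm.

Definition isSt (A : (nat -> num M -> Prop) -> num M -> Prop) : Prop :=
  (exists i, A = fun S => S i) \/ (exists2 X, sets X & A = fun _ => X).

Definition isF (b : bool) (P : (nat -> num M) -> (nat -> num M -> Prop) -> Prop) :=
  exists phi d E, [/\ class b phi, set_env E
    & forall e S, P e S <-> sat (mix e d) (mix S E) phi].

Definition isS1 (P : (nat -> num M) -> Prop) :=
  exists2 Q, isF false (fun e S => Q e) & forall e, P e <-> exists x, Q (scons x e).

(** Two parameter lists are interleaved into one: parameter j of the left formula moves to place 2j,
    parameter j of the right one to place 2j+1, and the context variables stay fixed. *)
Definition lren (i : nat) : nat := if odd i then i./2.*2.*2.+1 else i.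
Definition rren (i : nat) : nat := if odd i then i./2.*2.+1.*2.+1 else i.

Lemma mix_even (T : Type) (e d : nat -> T) i : mix e d i.*2 = e i.
Proof. by rewrite /mix odd_double doubleK. Qed.

Lemma mix_odd (T : Type) (e d : nat -> T) i : mix e d i.*2.+1 = d i.
Proof. by rewrite /mix /= odd_double /= uphalf_double. Qed.

Lemma half_even i : odd i = false -> i = i./2.*2.
Proof. by move=> h; have := odd_double_half i; rewrite h. Qed.

Lemma mix_lren (T : Type) (e d d' : nat -> T) :
  (fun i => mix e (mix d d') (lren i)) = mix e d.
Proof.
apply: functional_extensionality => i; rewrite /lren.
by case h: (odd i); rewrite /mix h ?(mix_odd, h) //= !odd_double /= uphalf_double odd_double doubleK.
Qed.

Lemma mix_rren (T : Type) (e d d' : nat -> T) :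
  (fun i => mix e (mix d d') (rren i)) = mix e d'.
Proof.
apply: functional_extensionality => i; rewrite /rren.
by case h: (odd i); rewrite /mix h ?h //= !odd_double /= uphalf_double /= odd_double /= uphalf_double.
Qed.

Lemma tm_join t u : isTm t -> isTm u ->
  exists tm um d, forall e, t e = eval (mix e d) tm /\ u e = eval (mix e d) um.
Proof.
move=> [tm [d ht]] [um [d' hu]].
exists (tren lren tm), (tren rren um), (mix d d') => e.
by rewrite !eval_tren mix_lren mix_rren.
Qed.

Lemma tmF_join t b P : isTm t -> isF b P -> exists tm phi d E,
  [/\ class b phi, set_env E, forall e, t e = eval (mix e d) tm
    & forall e S, P e S <-> sat (mix e d) (mix S E) phi].
Proof.
move=> [tm [d ht]] [phi [d' [E [hc hE hP]]]].
exists (tren lren tm), (fren rren id phi), (mix d d'), E; split=> //.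
- exact: class_fren.
- by move=> e; rewrite eval_tren mix_lren.
- by move=> e S; rewrite sat_fren mix_rren.
Qed.

Lemma set_env_mix E E' : set_env E -> set_env E' -> set_env (mix E E').
Proof. by move=> h h' i; rewrite /mix; case: odd. Qed.

Lemma F_join b b' P Q : isF b P -> isF b' Q -> exists phi psi d E,
  [/\ class b phi /\ class b' psi, set_env E,
      forall e S, P e S <-> sat (mix e d) (mix S E) phi
    & forall e S, Q e S <-> sat (mix e d) (mix S E) psi].
Proof.
move=> [phi [d [E [hc hE hP]]]] [psi [d' [E' [hc' hE' hQ]]]].
exists (fren lren lren phi), (fren rren rren psi), (mix d d'), (mix E E'); split.
- by split; apply: class_fren.
- exact: set_env_mix.
- by move=> e S; rewrite sat_fren !mix_lren.
- by move=> e S; rewrite sat_fren !mix_rren.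
Qed.

Lemma tm_var i : isTm (fun e => e i).
Proof. by exists (TVar i.*2), (fun _ => 0) => e /=; rewrite mix_even. Qed.

Lemma tm_const c : isTm (fun _ => c).
Proof. by exists (TVar 1), (fun _ => c). Qed.

Lemma tm_add t u : isTm t -> isTm u -> isTm (fun e => t e + u e).
Proof.
move=> ht hu; have [tm [um [d h]]] := tm_join ht hu.
by exists (TAdd tm um), d => e /=; have [-> ->] := h e.
Qed.

Lemma tm_mul t u : isTm t -> isTm u -> isTm (fun e => t e * u e).
Proof.
move=> ht hu; have [tm [um [d h]]] := tm_join ht hu.
by exists (TMul tm um), d => e /=; have [-> ->] := h e.
Qed.

Lemma tm_ren r t : isTm t -> isTm (fun e => t (fun i => e (r i))).
Proof.
move=> [tm [d h]]; exists (tren (fun i => if odd i then i else (r i./2).*2) tm), d.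
move=> e; rewrite h eval_tren; congr eval.
apply: functional_extensionality => i.
by case hi: (odd i); rewrite ?mix_even /mix hi.
Qed.

Lemma f_ren b r P : isF b P -> isF b (fun e S => P (fun i => e (r i)) S).
Proof.
move=> [phi [d [E [hc hE h]]]].
exists (fren (fun i => if odd i then i else (r i./2).*2) id phi), d, E; split=> //.
  exact: class_fren.
move=> e S; rewrite h sat_fren.
suff -> : mix (fun i => e (r i)) d = (fun i => mix e d (if odd i then i else (r i./2).*2)) by [].
apply: functional_extensionality => i.
by case hi: (odd i); rewrite ?mix_even /mix hi.
Qed.

Lemma f_iff b P Q : (forall e S, P e S <-> Q e S) -> isF b Q -> isF b P.
Proof.
by move=> hPQ [phi [d [E [hc hE h]]]]; exists phi, d, E; split=> // e S; rewrite hPQ.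
Qed.

Lemma f_weak b P : isF false P -> isF b P.
Proof.
by move=> [phi [d [E [[//|hc] hE h]]]]; exists phi, d, E; split=> //; right.
Qed.

Lemma st_const X : sets X -> isSt (fun _ => X).
Proof. by move=> h; right; exists X. Qed.

Lemma st_var i : isSt (fun S => S i).
Proof. by left; exists i. Qed.

Lemma st_ren r A : isSt A -> isSt (fun S => A (fun i => S (r i))).
Proof. by case=> [[i ->]|[X hX ->]]; [left; exists (r i) | right; exists X]. Qed.

(** A quantifier binds index 0 and shifts everything else by one, which flips the parity convention.
    The renaming restores it: the parameter at an odd i is now at i+1, the context variable at an
    even i > 0 is now at i-1. *)
Lemma mix_scons (T : Type) (x : T) (e d : nat -> T) :
  (fun i => scons x (mix e d) (if odd i then i.+1 else i.-1)) = mix (scons x e) d.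
Proof.
apply: functional_extensionality => i.
case h: (odd i); first by rewrite /= /mix h.
have := half_even h; case: (i./2) => [|j] hi; first by rewrite hi.
by rewrite hi mix_even doubleS /= mix_even.
Qed.

(* Without any set in the structure no [set_env] exists. *)
Context (X0 : num M -> Prop) (sX0 : sets X0).

Lemma f_atom P : (exists phi d, Delta00 phi /\
    forall e S, P e S <-> sat (mix e d) (mix S (fun _ => X0)) phi) ->
  forall b, isF b P.
Proof. by move=> [phi [d [h1 h2]]] b; exists phi, d, (fun _ => X0); split=> //; right. Qed.

Lemma f_eq b t u : isTm t -> isTm u -> isF b (fun e S => t e = u e).
Proof.
move=> ht hu; have [tm [um [d h]]] := tm_join ht hu.
by apply: f_atom; exists (Eq tm um), d; split=> // e S /=; have [-> ->] := h e.
Qed.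

Lemma f_lt b t u : isTm t -> isTm u -> isF b (fun e S => t e < u e).
Proof.
move=> ht hu; have [tm [um [d h]]] := tm_join ht hu.
by apply: f_atom; exists (Lt tm um), d; split=> // e S /=; have [-> ->] := h e.
Qed.

Lemma f_in b A t : isSt A -> isTm t -> isF b (fun e S => A S (t e)).
Proof.
move=> hA [tm [d h]]; case: hA => [[i ->]|[X hX ->]].
  apply: f_atom; exists (In tm i.*2), d; split=> // e S /=.
  by rewrite mix_even h.
exists (In tm 1), d, (fun _ => X); split=> //; first by right.
by move=> e S /=; rewrite /mix /= h.
Qed.

Lemma f_in_var b i t : isTm t -> isF b (fun e S => S i (t e)).
Proof. exact: (@f_in b (fun S => S i) t (st_var i)). Qed.

Lemma f_not b P : isF b P -> isF b (fun e S => ~ P e S).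
Proof.
move=> [phi [d [E [hc hE h]]]]; exists (Not phi), d, E; split=> //.
by move=> e S /=; rewrite h.
Qed.

Lemma f_and b P Q : isF b P -> isF b Q -> isF b (fun e S => P e S /\ Q e S).
Proof.
move=> hP hQ; have [phi [psi [d [E [[c1 c2] hE h1 h2]]]]] := F_join hP hQ.
exists (And phi psi), d, E; split=> //.
  by case: c1 => ?; case: c2 => ?; by [left | right].
by move=> e S /=; rewrite h1 h2.
Qed.

Lemma f_or b P Q : isF b P -> isF b Q -> isF b (fun e S => P e S \/ Q e S).
Proof.
move=> hP hQ; have [phi [psi [d [E [[c1 c2] hE h1 h2]]]]] := F_join hP hQ.
exists (Or phi psi), d, E; split=> //.
  by case: c1 => ?; case: c2 => ?; by [left | right].
by move=> e S /=; rewrite h1 h2.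
Qed.

Lemma f_imp b P Q : isF b P -> isF b Q -> isF b (fun e S => P e S -> Q e S).
Proof.
move=> hP hQ; have [phi [psi [d [E [[c1 c2] hE h1 h2]]]]] := F_join hP hQ.
exists (Imp phi psi), d, E; split=> //.
  by case: c1 => ?; case: c2 => ?; by [left | right].
by move=> e S /=; rewrite h1 h2.
Qed.

Lemma f_equiv b P Q : isF b P -> isF b Q -> isF b (fun e S => P e S <-> Q e S).
Proof. by move=> hP hQ; apply: f_and; apply: f_imp. Qed.

Lemma f_ball b t Q : isTm t -> isF b (fun e S => Q (fun i => e i.+1) S (e 0%N)) ->
  isF b (fun e S => forall x, x < t e -> Q e S x).
Proof.
move=> ht hQ; have [tm [phi [d [E [hc hE h1 h2]]]]] := tmF_join ht hQ.
exists (BAll tm (fren (fun i => if odd i then i.+1 else i.-1) id phi)), d, E.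
split=> //; first by case: hc => hc; [left | right; apply: Delta00_fren].
move=> e S /=; rewrite -h1.
by split=> h x /h; rewrite sat_fren mix_scons -h2.
Qed.

Lemma f_bex b t Q : isTm t -> isF b (fun e S => Q (fun i => e i.+1) S (e 0%N)) ->
  isF b (fun e S => exists x, x < t e /\ Q e S x).
Proof.
move=> ht hQ; have [tm [phi [d [E [hc hE h1 h2]]]]] := tmF_join ht hQ.
exists (BEx tm (fren (fun i => if odd i then i.+1 else i.-1) id phi)), d, E.
split=> //; first by case: hc => hc; [left | right; apply: Delta00_fren].
move=> e S /=; rewrite -h1.
by split=> -[x [hx h]]; exists x; split=> //; move: h; rewrite sat_fren mix_scons -h2.
Qed.

Lemma f_all Q : isF true (fun e S => Q (fun i => e i.+1) S (e 0%N)) ->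
  isF true (fun e S => forall x, Q e S x).
Proof.
move=> [phi [d [E [hc hE h2]]]].
exists (All (fren (fun i => if odd i then i.+1 else i.-1) id phi)), d, E.
split=> //; first by left.
by move=> e S /=; split=> h x; have := h x; rewrite sat_fren mix_scons -h2.
Qed.

Lemma f_ex Q : isF true (fun e S => Q (fun i => e i.+1) S (e 0%N)) ->
  isF true (fun e S => exists x, Q e S x).
Proof.
move=> [phi [d [E [hc hE h2]]]].
exists (Ex (fren (fun i => if odd i then i.+1 else i.-1) id phi)), d, E.
split=> //; first by left.
by move=> e S /=; split=> -[x h]; exists x; move: h; rewrite sat_fren mix_scons -h2.
Qed.

Lemma f_sall Q : isF true (fun e S => Q e (fun i => S i.+1) (S 0%N)) ->
  isF true (fun e S => forall X, sets X -> Q e S X).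
Proof.
move=> [phi [d [E [hc hE h2]]]].
exists (SAll (fren id (fun i => if odd i then i.+1 else i.-1) phi)), d, E.
split=> //; first by left.
by move=> e S /=; split=> h X hX; have := h X hX; rewrite sat_fren mix_scons -h2.
Qed.

Lemma scons_eta (T : Type) (e : nat -> T) : scons (e 0%N) (fun i => e i.+1) = e.
Proof. by apply: functional_extensionality; case. Qed.

Lemma f_s1 P : isS1 P -> isF true (fun e S => P e).
Proof.
move=> [Q hQ h]; apply: (f_iff (fun e S => h e)); apply: f_ex.
by apply: f_weak; apply: f_iff hQ => e S; rewrite scons_eta.
Qed.

Lemma tm_eval (s : nat -> (nat -> num M) -> num M) t :
  (forall i, isTm (s i)) -> isTm (fun e => eval (fun i => s i e) t).
Proof.
move=> hs; elim: t => [i| | |t ht u hu|t ht u hu] /=; first exact: hs.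
- exact: tm_const.
- exact: tm_const.
- exact: tm_add.
- exact: tm_mul.
Qed.

Definition lift_tm (s : nat -> (nat -> num M) -> num M) : nat -> (nat -> num M) -> num M :=
  scons (fun e => e 0%N) (fun i e => s i (fun j => e j.+1)).

Lemma tm_lift s : (forall i, isTm (s i)) -> forall i, isTm (lift_tm s i).
Proof. by move=> hs [|i] /=; [apply: tm_var | apply: tm_ren]. Qed.

Lemma lift_tmE s e :
  scons (e 0%N) (fun i => s i (fun j => e j.+1)) = (fun i => lift_tm s i e).
Proof. by apply: functional_extensionality; case. Qed.

(** Substitution is done semantically: the formula is rebuilt connective by connective over an
    environment of terms. This yields closure of [isF false] under substitution without a
    substitution operation on syntax. *)
Lemma f_sat phi A s : Delta00 phi -> (forall i, isSt (A i)) -> (forall i, isTm (s i)) ->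
  isF false (fun e S => sat (fun i => s i e) (fun i => A i S) phi).
Proof.
move=> + hA; elim: phi s => //=
  [t u|t u|t i|p IHp|p IHp q IHq|p IHp q IHq|p IHp q IHq|t p IHp|t p IHp] s.
- by move=> _ hs; apply: f_eq; apply: tm_eval.
- by move=> _ hs; apply: f_lt; apply: tm_eval.
- by move=> _ hs; apply: f_in; [apply: hA | apply: tm_eval].
- by move=> /IHp h /h hs; apply: f_not.
- by move=> [/IHp h /IHq h'] hs; apply: f_and; [apply: h | apply: h'].
- by move=> [/IHp h /IHq h'] hs; apply: f_or; [apply: h | apply: h'].
- by move=> [/IHp h /IHq h'] hs; apply: f_imp; [apply: h | apply: h'].
- move=> /IHp h hs; apply: f_ball; first exact: tm_eval.
  apply: f_iff (h _ (tm_lift hs)) => e S.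
  by rewrite -lift_tmE.
- move=> /IHp h hs; apply: f_bex; first exact: tm_eval.
  apply: f_iff (h _ (tm_lift hs)) => e S.
  by rewrite -lift_tmE.
Qed.

Lemma f_subst P s : isF false P -> (forall i, isTm (s i)) ->
  isF false (fun e S => P (fun i => s i e) S).
Proof.
move=> [phi [d [E [[//|hc] hE h]]]] hs.
apply: (@f_iff _ _ (fun e S =>
  sat (fun i => mix s (fun j _ => d j) i e) (fun i => mix (fun j S => S j) (fun j _ => E j) i S) phi)).
  move=> e S; rewrite h.
  have -> : (fun i => mix s (fun j _ => d j) i e) = mix (fun i => s i e) d.
    by apply: functional_extensionality => i; rewrite /mix; case: odd.
  suff -> : (fun i => mix (fun j S => S j) (fun j _ => E j) i S) = mix S E by [].
  by apply: functional_extensionality => i; rewrite /mix; case: odd.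
apply: f_sat => // i; rewrite /mix; case: odd => //.
- exact: st_const.
- exact: st_var.
- exact: tm_const.
Qed.

Lemma s1_subst P s : isS1 P -> (forall i, isTm (s i)) -> isS1 (fun e => P (fun i => s i e)).
Proof.
move=> [Q hQ h] hs; exists (fun e => Q (fun i => lift_tm s i e)).
  exact: (f_subst (P := fun e S => Q e) hQ (tm_lift hs)).
by move=> e; rewrite h; split=> -[x hx]; exists x; move: hx; rewrite -lift_tmE.
Qed.

Lemma s1_subst1 (P : num M -> Prop) : isS1 (fun e => P (e 0%N)) ->
  forall t, isTm t -> isS1 (fun e => P (t e)).
Proof. by move=> h t ht; apply: (s1_subst (s := fun _ => t) h). Qed.

Lemma s1_subst2 (P : num M -> num M -> Prop) : isS1 (fun e => P (e 0%N) (e 1%N)) ->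
  forall t u, isTm t -> isTm u -> isS1 (fun e => P (t e) (u e)).
Proof.
move=> h t u ht hu; apply: (s1_subst (s := scons t (fun _ => u)) h).
by case.
Qed.

Lemma s1_sat phi E s : Sigma01 phi -> set_env E -> (forall i, isTm (s i)) ->
  isS1 (fun e => sat (fun i => s i e) E phi).
Proof.
move=> [theta hth ->] hE hs.
exists (fun e => sat (fun i => lift_tm s i e) E theta).
  apply: (@f_sat _ (fun i _ => E i)) => //; last exact: tm_lift.
  by move=> i; apply: st_const.
by move=> e /=; split=> -[x h]; exists x; move: h; rewrite -lift_tmE.
Qed.

(** The layout of the axioms: K context variables in front, parameters behind them. [trunc] replaces
    all further context variables by the value of variable 0, so that only the first K matter. *)
Definition glue (K : nat) e d (i : nat) : num M := if (i < K)%N then e i else d (i - K)%N.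
Definition trunc (K : nat) e (i : nat) : num M := if (i < K)%N then e i else e 0%N.

Lemma s1_formula (K : nat) P P' : isS1 P -> isS1 P' -> exists phi psi d E,
  [/\ Delta00 phi /\ Delta00 psi, set_env E,
      forall e, P (trunc K.+1 e) <-> sat (glue K.+1 e d) E (Ex phi)
    & forall e, P' (trunc K.+1 e) <-> sat (glue K.+1 e d) E (Ex psi)].
Proof.
move=> [Q hQ hP] [Q' hQ' hP'].
have [phi [psi [d [E [[c1 c2] hE h1 h2]]]]] := F_join hQ hQ'.
(* Index 0 is the witness of the leading quantifier, indices 1 to K+1 are the context and the
   parameters start at K+2. Context variables out of range go to index 1, in agreement with
   [trunc]. *)
pose r i := if odd i then (i./2 + K.+2)%N else
  if i./2 is j.+1 then (if (j < K.+1)%N then j.+1 else 1%N) else 0%N.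
pose s i := if odd i then i./2.+1 else 0%N.
have hs : (fun i => scons X0 E (s i)) = mix (fun _ => X0) E.
  by apply: functional_extensionality => i; rewrite /s /mix; case: odd.
have hr x e : (fun i => scons x (glue K.+1 e d) (r i)) = mix (scons x (trunc K.+1 e)) d.
  apply: functional_extensionality => i; rewrite /r /mix; case: odd.
    by rewrite !addnS /= /glue ltnNge -addnS leq_addl /= addnK.
  case: (i./2) => [|j] //; rewrite /= /trunc.
  by case: ifP => h /=; rewrite /glue ?h.
exists (fren r s phi), (fren r s psi), d, (scons X0 E); split.
- by split; apply: Delta00_fren; [case: c1 | case: c2].
- by case.
- by move=> e; rewrite hP /=; split=> -[x h]; exists x; move: h; rewrite sat_fren (h1 _ (fun _ => X0)) hr hs.
- by move=> e; rewrite hP' /=; split=> -[x h]; exists x; move: h; rewrite sat_fren (h2 _ (fun _ => X0)) hr hs.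
Qed.

Lemma glue1 n d : glue 1 (fun _ => n) d = scons n d.
Proof. by apply: functional_extensionality => -[|i]; rewrite /glue //= subn1. Qed.

Context (hM : RCA0 M).

(** * Induction and comprehension for definable predicates *)

Lemma s1_ind (P : num M -> Prop) : isS1 (fun e => P (e 0%N)) ->
  P 0 -> (forall n, P n -> P (n + 1)) -> forall n, P n.
Proof.
move=> hP; have [_ ind _] := hM.
have [phi [_ [d [E [[c _] hE h _]]]]] := s1_formula 0 hP hP.
have {}h n : P n <-> sat (scons n d) E (Ex phi) by rewrite -glue1 -h.
move=> h0 hS n; apply/h; apply: ind => //; first by exists phi.
  exact/h.
by move=> k /h /hS /h.
Qed.

Lemma s1_comprehension (P : num M -> Prop) :
  isS1 (fun e => P (e 0%N)) -> isS1 (fun e => ~ P (e 0%N)) ->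
  exists X, sets X /\ forall n, X n <-> P n.
Proof.
move=> hP hP'; have [_ _ comp] := hM.
have [phi [psi [d [E [[c c'] hE h h']]]]] := s1_formula 0 hP hP'.
have {}h n : P n <-> sat (scons n d) E (Ex phi) by rewrite -glue1 -h.
have {}h' n : P n <-> sat (scons n d) E (All (Not psi)).
  have := h' (fun _ => n); rewrite glue1 /= => h2; split=> [p x hx|].
    by apply: (proj2 h2) => //; exists x.
  by move=> h3; apply: NNPP => /h2 [x hx]; apply: (h3 x).
have [X [sX hX]] := comp (Ex phi) (All (Not psi)) d E
  ltac:(by exists phi) ltac:(by exists (Not psi)) hE ltac:(by move=> n; rewrite -h -h').
by exists X; split=> // n; rewrite hX h.
Qed.

(** Sigma^0_1 induction with exactly one existential quantifier. It serves to develop the order, on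
    which closure of Sigma^0_1 under further quantifiers depends. *)
Lemma ind_ex (Q : num M -> num M -> Prop) : isF false (fun e S => Q (e 0%N) (e 1%N)) ->
  (exists k, Q k 0) -> (forall n k, Q k n -> exists k', Q k' (n + 1)) ->
  forall n, exists k, Q k n.
Proof.
move=> hQ h0 hS n; apply: (s1_ind (P := fun n => exists k, Q k n)) => //.
  by exists (fun e => Q (e 0%N) (e 1%N)).
by move=> k [l /hS].
Qed.

Lemma d0_ind (P : num M -> Prop) : isF false (fun e S => P (e 0%N)) ->
  P 0 -> (forall n, P n -> P (n + 1)) -> forall n, P n.
Proof.
move=> hP h0 hS n.
suff [] : exists k : num M, P n by [].
apply: (ind_ex (Q := fun _ n => P n)) => [||m k /hS hm]; last by exists 0.
  exact: f_ren hP.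
by exists 0.
Qed.

Ltac def_tm := cbn beta;
  lazymatch goal with
  | |- isTm (fun e => @add _ _ _) => apply: tm_add; def_tm
  | |- isTm (fun e => @mul _ _ _) => apply: tm_mul; def_tm
  | |- isTm (fun e => @pair _ _ _) => apply: tm_add; [apply: tm_mul |]; def_tm
  | |- _ => first [assumption | exact: tm_var | exact: tm_const | apply: tm_ren; assumption]
  end.

Create HintDb definable.

(** Syntax-directed: the head connective selects the closure lemma, and bounded quantifier rules are
    tried before unbounded ones. Each notion later shown definable joins the database
    [definable]. *)
Ltac def := cbn beta;
  lazymatch goal with
  | |- isTm _ => def_tm
  | |- isF _ (fun e S => @eq (num M) _ _) => apply: f_eq; def_tm
  | |- isF _ (fun e S => @lt _ _ _) => apply: f_lt; def_tm
  | |- isF _ (fun e S => @le _ _ _) => apply: f_or; def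
  | |- isF _ (fun e S => ~ _) => apply: f_not; def
  | |- isF _ (fun e S => _ /\ _) => apply: f_and; def
  | |- isF _ (fun e S => _ \/ _) => apply: f_or; def
  | |- isF _ (fun e S => _ <-> _) => apply: f_equiv; def
  | |- isF _ (fun e S => exists x : num M, _) => first [apply: f_bex | apply: f_ex]; def
  | |- isF _ (fun e S => forall X : num M -> Prop, _) => apply: f_sall; def
  | |- isF _ (fun e S => forall x : num M, _) => first [apply: f_ball | apply: f_all]; def
  | |- isF _ (fun e S => _ -> _) => apply: f_imp; def
  | |- isF true _ => first [def_leaf | apply: f_s1; def_leaf]
  | |- _ => def_leaf
  end
with def_leaf := first
  [ match goal with h : _ |- _ => apply: h; def_tm end
  | solve [auto 1 with definable nocore]
  | eapply f_in_var; def_tm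
  | eapply f_in; [first [exact: st_var | apply: st_const; assumption | assumption | apply: st_ren; assumption] | def_tm] ].

(** * Arithmetic and order from the basic axioms *)

Implicit Types (a b c k l m n x y z w : num M).

Lemma succ_neq0 n : n + 1 <> 0.
Proof. by have [[h _] _ _] := hM; apply: h. Qed.

Lemma succ_inj m n : m + 1 = n + 1 -> m = n.
Proof. by have [[_ [h _]] _ _] := hM; apply: h. Qed.

Lemma addn0 n : n + 0 = n.
Proof. by have [[_ [_ [h _]]] _ _] := hM; apply: h. Qed.

Lemma addnS m n : m + (n + 1) = m + n + 1.
Proof. by have [[_ [_ [_ [h _]]]] _ _] := hM; apply: h. Qed.

Lemma muln0 n : n * 0 = 0.
Proof. by have [[_ [_ [_ [_ [h _]]]]] _ _] := hM; apply: h. Qed.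

Lemma mulnS m n : m * (n + 1) = m * n + m.
Proof. by have [[_ [_ [_ [_ [_ [h _]]]]]] _ _] := hM; apply: h. Qed.

Lemma ltn0 n : ~ n < 0.
Proof. by have [[_ [_ [_ [_ [_ [_ [h _]]]]]]] _ _] := hM; apply: h. Qed.

Lemma ltnS m n : m < n + 1 <-> m <= n.
Proof. by have [[_ [_ [_ [_ [_ [_ [_ h]]]]]]] _ _] := hM; apply: h. Qed.

Lemma add0n n : 0 + n = n.
Proof. by elim/d0_ind: n => [||n h]; [def | rewrite addn0 | rewrite addnS h]. Qed.

Lemma addSn m n : m + 1 + n = m + n + 1.
Proof.
by elim/d0_ind: n => [||n h]; [def | rewrite !addn0 | rewrite !addnS h].
Qed.

Lemma addnC m n : m + n = n + m.
Proof.
by elim/d0_ind: n => [||n h]; [def | rewrite addn0 add0n | rewrite addnS h addSn].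
Qed.

Lemma addnA m n p : m + (n + p) = m + n + p.
Proof.
by elim/d0_ind: p => [||p h]; [def | rewrite !addn0 | rewrite !addnS h].
Qed.

Lemma mul0n n : 0 * n = 0.
Proof. by elim/d0_ind: n => [||n h]; [def | rewrite muln0 | rewrite mulnS h addn0]. Qed.

Lemma mulSn m n : (m + 1) * n = m * n + n.
Proof.
elim/d0_ind: n => [||n h]; [def | by rewrite !muln0 addn0 |].
by rewrite !mulnS h !addnS; congr (_ + 1); rewrite -!addnA (addnC n).
Qed.

Lemma mulnC m n : m * n = n * m.
Proof.
by elim/d0_ind: n => [||n h]; [def | rewrite muln0 mul0n | rewrite mulnS h mulSn].
Qed.

Lemma mulnDr m n p : m * (n + p) = m * n + m * p.
Proof.
by elim/d0_ind: p => [||p h]; [def | rewrite muln0 !addn0 | rewrite addnS !mulnS h addnA].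
Qed.

Lemma mulnA m n p : m * (n * p) = m * n * p.
Proof.
by elim/d0_ind: p => [||p h]; [def | rewrite !muln0 | rewrite !mulnS mulnDr h].
Qed.

Lemma mul1n n : 1 * n = n.
Proof. by rewrite -[X in X * _]add0n mulSn mul0n add0n. Qed.

Lemma num_semiring : semi_ring_theory (0 : num M) 1 (@add M) (@mul M) eq.
Proof.
split; [exact: add0n | exact: addnC | exact: addnA | exact: mul1n | exact: mul0n
  | exact: mulnC | exact: mulnA |].
by move=> m n p; rewrite mulnC mulnDr !(mulnC p).
Qed.

Add Ring num_ring : num_semiring.

Lemma addIn k m n : m + k = n + k -> m = n.
Proof.
elim/d0_ind: k => [||k h]; [by def | by rewrite !addn0 |].
by rewrite !addnS => /succ_inj.
Qed.

Lemma addnI k m n : k + m = k + n -> m = n.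
Proof. by rewrite ![k + _]addnC; apply: addIn. Qed.

Lemma zero_or_succ n : n = 0 \/ exists m, n = m + 1.
Proof.
have [m [|h]] : exists m, n = 0 \/ n = m + 1; [|by left|by right; exists m].
move: n; apply: ind_ex => [||n k _]; first by def.
  by exists 0; left.
by exists n; right.
Qed.

(** The axioms give [<] only by recursion on its right argument. With this additive form,
    inequalities are settled by exhibiting a difference and calling [ring]. *)
Lemma ltP m n : m < n <-> exists k, n = m + k + 1.
Proof.
split=> [h|[k ->]].
  (* The implication is turned into a disjunction under one existential quantifier, the shape that
     [ind_ex] accepts. *)
  have [k [/(_ h)|->]] : exists k, ~ m < n \/ n = m + k + 1; [| by [] | by exists k].
  move: n {h}; apply: ind_ex => [||n k h]; first by def.
    by exists 0; left; apply: ltn0.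
  case: (classic (m < n)) => [hn|hn].
    by exists (k + 1); right; case: h => // ->; ring.
  case: (classic (m = n)) => [->|hmn]; first by (exists 0; right; ring).
  by exists 0; left=> /ltnS [].
elim/d0_ind: k => [||k h]; first by def.
  by apply/ltnS; right; ring.
by apply/ltnS; left; rewrite addnA.
Qed.

Lemma leP m n : m <= n <-> exists k, n = m + k.
Proof.
split=> [[/ltP [k ->]|->]|[k ->]]; first by (exists (k + 1); ring).
  by exists 0; ring.
case: (zero_or_succ k) => [->|[j ->]]; first by right; ring.
by left; apply/ltP; exists j; ring.
Qed.

Lemma ltle m n : m < n <-> m + 1 <= n.
Proof. by rewrite ltP leP; split=> -[k ->]; exists k; ring. Qed.

Lemma leqnn n : n <= n. Proof. by right. Qed.

Lemma leqw m n : m < n -> m <= n. Proof. by left. Qed.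

Lemma leq_trans n m p : m <= n -> n <= p -> m <= p.
Proof. by rewrite !leP => -[k ->] [l ->]; exists (k + l); ring. Qed.

Lemma lt_leq_trans n m p : m < n -> n <= p -> m < p.
Proof. by rewrite !ltle; apply: leq_trans. Qed.

Lemma leq_lt_trans n m p : m <= n -> n < p -> m < p.
Proof. by rewrite ltP !leP => -[k ->] [l ->]; apply/ltP; exists (k + l); ring. Qed.

Lemma lt_trans n m p : m < n -> n < p -> m < p.
Proof. by move=> h /leqw; apply: lt_leq_trans. Qed.

Lemma leq_addr m n : m <= m + n. Proof. by apply/leP; exists n. Qed.

Lemma leq_addl m n : m <= n + m. Proof. by rewrite addnC; apply: leq_addr. Qed.

Lemma leq0n n : 0 <= n. Proof. by apply/leP; exists n; rewrite add0n. Qed.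

Lemma ltnSn n : n < n + 1. Proof. by apply/ltnS; right. Qed.

Lemma addn_eq0 m n : m + n = 0 -> m = 0.
Proof.
by case: (zero_or_succ m) => // -[k ->]; rewrite addSn => /succ_neq0.
Qed.

Lemma ltnn n : ~ n < n.
Proof.
move=> /ltP [k]; rewrite -addnA -[X in X = _]addn0 => /addnI h.
exact: (@succ_neq0 k).
Qed.

Lemma ltnNge m n : m < n -> ~ n <= m.
Proof. by move=> h h'; apply: (@ltnn m); apply: lt_leq_trans h h'. Qed.

Lemma anti_leq m n : m <= n -> n <= m -> m = n.
Proof. by case=> // h /(ltnNge h). Qed.

Lemma leq_or_lt m n : m <= n \/ n < m.
Proof.
elim/d0_ind: n => [||n [h|h]]; first by def.
- by case: (zero_or_succ m) => [->|[k ->]]; [left; right | right; apply/ltP; exists k; ring].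
- by left; apply: leq_trans h (leq_addr _ _).
- by move/ltP: h => [k ->]; case: (zero_or_succ k) => [->|[j ->]];
    [left; right; ring | right; apply/ltP; exists j; ring].
Qed.

Lemma leq_total m n : m <= n \/ n <= m.
Proof. by case: (leq_or_lt m n) => [|/leqw]; [left | right]. Qed.

Lemma lt_total m n : m <> n -> m < n \/ n < m.
Proof. by move=> h; case: (leq_or_lt m n) => [[]|]; [left | | right]. Qed.

Lemma one_neq0 : (1 : num M) <> 0.
Proof. by rewrite -[X in X <> _]add0n; apply: succ_neq0. Qed.

Lemma leq_add2r k m n : m + k <= n + k -> m <= n.
Proof.
rewrite !leP => -[d h]; exists d; apply: (@addIn k); rewrite h; ring.
Qed.

Lemma lt_mulS k m n : m < n -> m * (k + 1) < n * (k + 1).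
Proof. by rewrite !ltP => -[d ->]; exists (d * (k + 1) + k); ring. Qed.

Lemma leq_mulS k m n : m * (k + 1) <= n * (k + 1) -> m <= n.
Proof. by case: (leq_or_lt m n) => // /lt_mulS h /(ltnNge (h k)). Qed.

(** * Closure of Sigma^0_1, collection, least number principle *)

Lemma s1_f P : isF false (fun e S => P e) -> isS1 P.
Proof.
move=> h; exists (fun e => P (fun i => e i.+1)).
  exact: (f_ren (fun i => i.+1) h).
by move=> e; split=> [h1|[x]//]; exists 0.
Qed.

Lemma s1_iff P Q : (forall e, P e <-> Q e) -> isS1 Q -> isS1 P.
Proof. by move=> h [R hR hQ]; exists R => // e; rewrite h. Qed.

Lemma lt_addS_l m n : m < m + n + 1. Proof. by apply/ltP; exists n. Qed.
Lemma lt_addS_r m n : n < m + n + 1. Proof. by rewrite (addnC m); apply: lt_addS_l. Qed.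

(** Two existential quantifiers merge by letting a single number bound both witnesses. *)
Lemma s1_ex Q : isS1 (fun e => Q (fun i => e i.+1) (e 0%N)) ->
  isS1 (fun e => exists x, Q e x).
Proof.
move=> [R hR h].
exists (fun e => exists x, x < e 0%N /\ exists y, y < e 0%N /\
                 R (scons y (scons x (fun i => e i.+1)))).
  apply: f_bex; [exact: tm_var|]; apply: f_bex; [exact: tm_var|].
  apply: f_iff (f_ren (fun i => match i with 0 | 1 => i | j.+2 => j.+3 end)%N hR) => e S.
  by apply: iff_of_eq; congr R; apply: functional_extensionality => -[|[|]].
move=> e; split=> [[x /(h (scons x e)) [y hy]]|[z [x [_ [y [_ hy]]]]]]; last first.
  by exists x; apply/(h (scons x e)); exists y.
exists (x + y + 1), x; split; first exact: lt_addS_l.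
by exists y; split; first exact: lt_addS_r.
Qed.

Lemma s1_or P Q : isS1 P -> isS1 Q -> isS1 (fun e => P e \/ Q e).
Proof.
move=> [R hR h] [R' hR' h']; exists (fun e => R e \/ R' e); first exact: f_or.
move=> e; rewrite h h'; split=> [[[x hx]|[x hx]]|[x [hx|hx]]].
- by exists x; left.
- by exists x; right.
- by left; exists x.
- by right; exists x.
Qed.

Lemma s1_and P Q : isS1 P -> isS1 Q -> isS1 (fun e => P e /\ Q e).
Proof.
move=> [R hR h] [R' hR' h'].
apply: (@s1_iff _ (fun e => exists x y, R (scons x e) /\ R' (scons y e))).
  move=> e; rewrite h h'; split=> [[[x hx] [y hy]]|[x [y [hx hy]]]].
    by exists x, y.
  by split; [exists x | exists y].
apply: s1_ex; apply: s1_ex; apply: s1_f; apply: f_and.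
  apply: f_iff (f_ren (fun i => i.+1)%N hR) => e S.
  by apply: iff_of_eq; congr R; apply: functional_extensionality => -[|].
apply: f_iff (f_ren (fun i => if i is j.+1 then j.+2 else i) hR') => e S.
by apply: iff_of_eq; congr R'; apply: functional_extensionality => -[|].
Qed.

Lemma s1_imp P Q : isF false (fun e S => P e) -> isS1 Q -> isS1 (fun e => P e -> Q e).
Proof.
move=> hP hQ; apply: (@s1_iff _ (fun e => ~ P e \/ Q e)).
  by move=> e; split=> [|[]//]; case: (classic (P e)); [right; auto | left].
by apply: s1_or => //; apply: s1_f; apply: f_not.
Qed.

Lemma collection (R : num M -> num M -> Prop) t :
  isF false (fun e S => R (e 0%N) (e 1%N)) ->
  (forall x, x < t -> exists y, R x y) ->
  exists b, forall x, x < t -> exists y, y < b /\ R x y.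
Proof.
move=> hR h.
have hR2 u v : isTm u -> isTm v -> isF false (fun e S => R (u e) (v e)).
  by move=> hu hv; apply: (f_subst (s := scons u (fun _ => v)) hR) => -[].
(* Induction on n with t held fixed: witnesses are known to exist only below t, so beyond it the
   bound is left unchanged. *)
suff /(_ t) [b hb] : forall n, exists b, forall x, x < n -> x < t -> exists y, y < b /\ R x y.
  by exists b => x hx; apply: hb.
apply: ind_ex => [||n b hb]; first by def.
  by exists 0 => x h0; case: (ltn0 h0).
case: (classic (n < t)) => [/h [y hy]|hn].
  exists (b + y + 1) => x /ltnS [hx hxt|-> _].
    by have [z [hz hR']] := hb x hx hxt; exists z; split=> //; apply: lt_trans hz (lt_addS_l _ _).
  by exists y; split=> //; apply: lt_addS_r.
by exists b => x /ltnS [/hb//|->].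
Qed.

Lemma s1_ball t Q : isTm t -> isS1 (fun e => Q (fun i => e i.+1) (e 0%N)) ->
  isS1 (fun e => forall x, x < t e -> Q e x).
Proof.
move=> ht [R hR h].
exists (fun e => forall x, x < t (fun i => e i.+1) ->
          exists y, y < e 0%N /\ R (scons y (scons x (fun i => e i.+1)))).
  apply: f_ball; [exact: tm_ren|]; apply: f_bex; [exact: tm_var|].
  apply: f_iff (f_ren (fun i => match i with 0 | 1 => i | j.+2 => j.+3 end)%N hR) => e S.
  by apply: iff_of_eq; congr R; apply: functional_extensionality => -[|[|]].
move=> e; split=> [hx|[b hb] x /hb [y [_ hy]]]; last by apply/(h (scons x e)); exists y.
change (exists b, forall x, x < t e -> exists y, y < b /\ R (scons y (scons x e))).
apply: (collection (R := fun x y => R (scons y (scons x e)))).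
  pose s := scons (fun e' => e' 1%N) (scons (fun e' => e' 0%N) (fun j (_ : nat -> num M) => e j)).
  have hs j : isTm (s j) by case: j => [|[|j]]; [exact: tm_var | exact: tm_var | exact: tm_const].
  apply: f_iff (f_subst hR hs) => e' S.
  by apply: iff_of_eq; congr R; apply: functional_extensionality => -[|[|]].
by move=> x /hx /(h (scons x e)).
Qed.

Hint Extern 1 (isS1 (fun e => _ /\ _)) => apply: s1_and; def : definable.
Hint Extern 1 (isS1 (fun e => _ \/ _)) => apply: s1_or; def : definable.
Hint Extern 1 (isS1 (fun e => exists x : num M, _)) => apply: s1_ex; def : definable.
Hint Extern 1 (isS1 (fun e => forall x : num M, _)) => apply: s1_ball; def : definable.
Hint Extern 1 (isS1 (fun e => _ -> _)) => apply: s1_imp; def : definable.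
Hint Extern 2 (isS1 _) => apply: s1_f; def : definable.

(** A counterexample a would descend: for each j up to a, the number a - j is again one. This is
    Sigma^0_1 in j, and at j = a it contradicts the base case. *)
Lemma p1_ind (P : num M -> Prop) : isS1 (fun e => ~ P (e 0%N)) ->
  P 0 -> (forall n, P n -> P (n + 1)) -> forall n, P n.
Proof.
move=> /(s1_subst1 (P := fun x => ~ P x)) hP h0 hS a; apply: NNPP => ha.
suff /(_ a) [/ltnn//|[b [hb]]] : forall j, a < j \/ exists b, b + j = a /\ ~ P b.
  by move: hb; rewrite -[X in _ = X]add0n => /addIn ->.
apply: s1_ind => [||j [h|[b [hb hPb]]]]; first by def.
- by right; exists a; rewrite addn0.
- by left; apply: lt_trans h (ltnSn _).
case: (zero_or_succ b) => [b0|[c bc]]; first by case: hPb; rewrite b0.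
by right; exists c; split=> [|/hS]; [rewrite -hb bc; ring | rewrite -bc].
Qed.

Lemma least (P : num M -> Prop) a : isS1 (fun e => P (e 0%N)) -> P a ->
  exists n, P n /\ forall m, m < n -> ~ P m.
Proof.
move=> /s1_subst1 hP ha; apply: NNPP => hn.
suff h n : forall m, m < n -> ~ P m by apply: (h (a + 1) a) => //; apply: ltnSn.
move: n; apply: p1_ind => [|m /ltn0//|n IH m /ltnS [/IH//|->] hPn].
  apply: (@s1_iff _ (fun e => exists m, m < e 0%N /\ P m)); last by def.
  move=> e; split=> [h|[m [hm hPm]] h]; last exact: h hPm.
  by apply: NNPP => h'; apply: h => m hm hPm; apply: h'; exists m.
by apply: hn; exists n.
Qed.

(** * Coprime moduli and maximal sets of Sigma^0_1 facts *)

Definition dvd (d n : num M) := exists q, n = q * d.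

Lemma leq_mulr m n : n <> 0 -> m <= m * n.
Proof.
case: (zero_or_succ n) => [//|[k ->] _]; rewrite mulnS; exact: leq_addl.
Qed.

Lemma f_dvd (b : bool) s t : isTm s -> isTm t -> isF b (fun e S => dvd (s e) (t e)).
Proof.
move=> hs ht; apply: (@f_iff _ _ (fun e S => exists q, q < t e + 1 /\ t e = q * s e)).
  move=> e _; split=> [[q hq]|[q [_ hq]]]; last by exists q.
  case: (classic (s e = 0)) => h0.
    by exists 0; split; [apply/ltnS; apply: leq0n | rewrite hq h0; ring].
  by exists q; split=> //; apply/ltnS; rewrite hq; apply: leq_mulr.
by def.
Qed.
Hint Extern 1 (isF _ (fun e S => dvd _ _)) => apply: f_dvd; def_tm : definable.

Lemma dvd_mulr (d : num M) m n : dvd d m -> dvd d (n * m).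
Proof. by move=> [q ->]; exists (n * q); ring. Qed.

Lemma dvd_mull (d : num M) m n : dvd d m -> dvd d (m * n).
Proof. by rewrite mulnC; apply: dvd_mulr. Qed.

Lemma common_multiple (f : num M -> num M) k :
  (forall t, isTm t -> isTm (fun e => f (t e))) -> (forall i, f i <> 0) ->
  exists m, m <> 0 /\ forall i, i < k -> dvd (f i) m.
Proof.
move=> hf f0; move: k; apply: ind_ex => [||n m [m0 h]].
- by apply: f_and; [def | apply: f_ball; [def | apply: f_dvd; [apply: hf; def | def]]].
- by exists 1; split=> [|i /ltn0//]; apply: one_neq0.
exists (m * f n); split=> [|i /ltnS [/h|->]]; last by exists m.
  case: (zero_or_succ (f n)) => [/f0//|[k ->]]; rewrite mulnS addnC => /addn_eq0.
  exact: m0.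
exact: dvd_mull.
Qed.

(** The moduli of Goedel's beta function, the same as those in the coding of finite sets by
    [mem]. *)
Definition modulus m i := m * (i + 1) + 1.

Lemma dvd_sub a b (d : num M) x : a * d + x = b * d -> dvd d x.
Proof.
case: (leq_total a b) => /leP [c ->] h.
  by exists c; apply: (@addnI (a * d)); rewrite h; ring.
(* In this case b <= a, and the equation forces x = 0. *)
exists 0; rewrite mul0n; apply: (@addn_eq0 _ (c * d)).
by apply: (@addnI (b * d)); rewrite addn0 -[RHS]h; ring.
Qed.

(* Gauss's lemma for two of the coprime numbers [modulus m i]: the relevant
   Bezout identity is (j+1) d_i + (i-j) = (i+1) d_j, and i-j divides m. *)
Lemma modulus_coprime m k i j x : (forall i, i < k -> dvd (i + 1) m) ->
  i < k -> j < k -> i <> j -> dvd (modulus m j) (modulus m i * x) -> dvd (modulus m j) x.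
Proof.
move=> hm hi hj hij [q hq].
have hqd a : a * q * modulus m j = a * (modulus m i * x) by rewrite hq; ring.
case: (lt_total hij) => /ltP [u hu].
  have [|w hw] := hm u.
    by apply: leq_lt_trans hj; rewrite hu; apply/leP; exists (i + 1); ring.
  (* Multiply the identity by w (j+1) x. As m = w (u+1) and u+1 = j-i, the difference term becomes m
     (j+1) x, that is, d_j x - x; so x is a difference of multiples of d_j. The other case is
     symmetric. *)
  apply: (@dvd_sub (w * (j + 1) * (j + 1) * q) (w * (i + 1) * (j + 1) * x + x)).
  by rewrite hqd /modulus hw hu; ring.
have [|w hw] := hm u.
  by apply: leq_lt_trans hi; rewrite hu; apply/leP; exists (j + 1); ring.
apply: (@dvd_sub (w * (i + 1) * (j + 1) * x) (w * (j + 1) * (j + 1) * q + x)).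
have -> : (w * (j + 1) * (j + 1) * q + x) * modulus m j =
  w * (j + 1) * (j + 1) * q * modulus m j + x * modulus m j by ring.
by rewrite hqd /modulus hw hu; ring.
Qed.

(* The least nonzero n with [d_i | n \/ W i t] for some [t] makes the set of
   i < k with [W i t] maximal: by coprimality, dividing n by d_i only destroys
   divisibility by d_i. *)
Lemma maximize (P : num M -> Prop) (W : num M -> num M -> Prop) k m t0 :
  isS1 (fun e => P (e 0%N)) -> isS1 (fun e => W (e 0%N) (e 1%N)) ->
  m <> 0 -> (forall i, i < k -> dvd (i + 1) m) -> P t0 ->
  exists t n, [/\ P t, forall i, i < k -> dvd (modulus m i) n \/ W i t
    & forall t', P t' -> (forall i, i < k -> W i t -> W i t') ->
      forall i, i < k -> W i t' -> ~ dvd (modulus m i) n].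
Proof.
move=> /s1_subst1 hP /s1_subst2 hW m0 hm ht0.
pose Q n := n <> 0 /\ exists t, P t /\ forall i, i < k -> dvd (modulus m i) n \/ W i t.
have hQ : isS1 (fun e => Q (e 0%N)) by rewrite /Q /modulus; def.
have [n0 hn0] : exists n, n <> 0 /\ forall i, i < k -> dvd (modulus m i) n.
  apply: common_multiple => [t ht|i]; first by rewrite /modulus; def.
  exact: succ_neq0.
have [] := @least Q n0 hQ.
  by case: hn0 => ? h; split=> //; exists t0; split=> // i /h; left.
move=> n [[n1 [t [ht h]]] hmin]; exists t, n; split=> // t' ht' hle i hi hWi [n' hn'].
have n'0 : n' <> 0 by move=> h0; apply: n1; rewrite hn' h0 mul0n.
apply: (hmin n').
  (* A nonzero m makes the modulus at least 2, so the quotient n' is smaller than n. *)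
  rewrite hn'; case: (zero_or_succ m) => [//|[p ->]].
  case: (zero_or_succ n') => [//|[u ->]].
  by apply/ltP; exists (p * (i + 1) * (u + 1) + i * (u + 1) + u); rewrite /modulus; ring.
split=> //; exists t'; split=> // j hj.
case: (classic (j = i)) => [->|hji]; first by right.
case: (h j hj) => [hd|hWj]; last by right; apply: hle.
left; apply: (modulus_coprime hm hi hj) => //; first by move=> hij; apply: hji.
by rewrite mulnC -hn'.
Qed.

(** * Pairs and codes of finite sets *)

Lemma leq_pair_l m n : m <= pair m n.
Proof. by apply/leP; rewrite /pair; exists ((m + n) * (m + n)); ring. Qed.

Lemma leq_sqr n : n <= n * n.
Proof. by case: (zero_or_succ n) => [->|[k ->]]; apply/leP; [exists 0 | exists ((k + 1) * k)]; ring. Qed.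

Lemma leq_pair_r m n : n <= pair m n.
Proof.
apply: leq_trans (leq_addl n m) _; apply: leq_trans (leq_sqr _) _; exact: leq_addr.
Qed.

(** The code of (p, q) lies between (p+q)^2 and (p+q+1)^2, the latter excluded, so a larger sum
    gives a larger code. *)
Lemma pair_sum_leq m n p q : pair m n = pair p q -> m + n <= p + q.
Proof.
move=> h; case: (leq_or_lt (m + n) (p + q)) => // /ltP [k hk]; exfalso.
apply: (@ltnn (pair p q)); rewrite -{2}h {2}/pair hk /pair; apply/ltP.
exists ((p + q) * (k + k + 1) + q + k * k + k + k + m); ring.
Qed.

Lemma pair_inj m n p q : pair m n = pair p q -> m = p /\ n = q.
Proof.
move=> h; have hs : m + n = p + q by apply: anti_leq; apply: pair_sum_leq.
have hm : m = p by move: h; rewrite /pair hs => /addnI.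
by split=> //; move: hs; rewrite hm => /addnI.
Qed.

Lemma mem_lt i c : mem i c -> i < c.
Proof. by move=> [k [m [n [-> [h _]]]]]; apply: lt_leq_trans h (leq_pair_l _ _). Qed.

Lemma memE i k m n : mem i (pair k (pair m n)) <-> i < k /\ dvd (modulus m i) n.
Proof.
split=> [[k' [m' [n' [/pair_inj [-> /pair_inj [-> ->]] [hi hd]]]]]|[hi hd]] //.
by exists k, m, n.
Qed.

(** A pair bounds its components, so the decoding quantifiers can be bounded by the code. The same
    device makes [compat], [string_ext] and [decides] bounded. *)
Lemma f_mem (b : bool) s t : isTm s -> isTm t -> isF b (fun e S => mem (s e) (t e)).
Proof.
move=> hs ht; apply: (@f_iff _ _ (fun e S => exists k, k < t e + 1 /\ exists m, m < t e + 1 /\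
  exists n, n < t e + 1 /\ (t e = pair k (pair m n) /\ s e < k /\ dvd (m * (s e + 1) + 1) n))).
  move=> e _; split=> [[k [m [n [hp h]]]]|[k [_ [m [_ [n [_ h]]]]]]]; last by exists k, m, n.
  have hk x : x <= t e -> x < t e + 1 by move/ltnS.
  have hmn : pair m n <= t e by rewrite hp; apply: leq_pair_r.
  exists k; split; first by apply: hk; rewrite hp; apply: leq_pair_l.
  exists m; split; first by apply: hk; apply: leq_trans hmn; apply: leq_pair_l.
  by exists n; split; first by apply: hk; apply: leq_trans hmn; apply: leq_pair_r.
by def.
Qed.
Hint Extern 1 (isF _ (fun e S => mem _ _)) => apply: f_mem; def_tm : definable.

Lemma f_is_fin (b : bool) t : isTm t -> isF b (fun e S => is_fin (t e)).
Proof.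
move=> ht; apply: (@f_iff _ _ (fun e S => forall c, c < t e ->
  ~ (forall i, i < t e -> (mem i c <-> mem i (t e))))); last by def.
move=> e _; split=> h c hc h'; apply: (h c hc) => i; last by move=> _; apply: h'.
split=> hi; first by apply/(h' i) => //; apply: lt_trans (mem_lt hi) hc.
by apply/(h' i) => //; apply: mem_lt.
Qed.
Hint Extern 1 (isF _ (fun e S => is_fin _)) => apply: f_is_fin; def_tm : definable.

(** The least number denoting the same set is the code. To apply [least], equality of the two sets
    is tested only below c + d, which exceeds all their members. *)
Lemma fin_code c : exists c', codes c' (fun i => mem i c).
Proof.
pose P (d : num M) := forall i, i < c + d -> (mem i d <-> mem i c).
have hP (d : num M) : P d <-> forall i, mem i d <-> mem i c.
  split=> h i; last by move=> _; apply: h.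
  split=> hi; apply/h => //; first exact: lt_leq_trans (mem_lt hi) (leq_addl _ _).
  exact: lt_leq_trans (mem_lt hi) (leq_addr _ _).
have [d [/hP hd hmin]] : exists c', P c' /\ forall x, x < c' -> ~ P x.
  by apply: (@least P c); [rewrite /P; def | apply/hP].
exists d; split=> // x hx h; apply: (hmin x hx); apply/hP => i.
by rewrite h hd.
Qed.

Lemma codes_ext c P Q : (forall i : num M, P i <-> Q i) -> codes c P -> codes c Q.
Proof. by move=> h [hc hP]; split=> // i; rewrite hP. Qed.

(** Bounded Sigma^0_1 comprehension, complemented: in [maximize] take W independent of the string.
    Then the i-th modulus divides n exactly when P fails at i, so n itself encodes the complement of
    P below k. *)
Lemma codes_not (P : num M -> Prop) k : isS1 (fun e => P (e 0%N)) ->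
  exists c, codes c (fun i => ~ P i /\ i < k).
Proof.
move=> /s1_subst1 hP.
have [m [m0 hm]] : exists m, m <> 0 /\ forall i, i < k -> dvd (i + 1) m.
  by apply: common_multiple => [t ht|i]; [def | apply: succ_neq0].
have [||_ [n [_ h1 h2]]] :=
  @maximize (fun t => t = t) (fun i _ => P i) k m 0 _ _ m0 hm erefl; try by def.
have [d hd] := fin_code (pair k (pair m n)); exists d.
apply: codes_ext hd => i; rewrite memE; split=> [[hi hdvd]|[hPi hi]].
  by split=> // hPi; apply: (h2 0 erefl _ i hi hPi hdvd).
by split=> //; case: (h1 i hi).
Qed.

Lemma bounded_codes (P : num M -> Prop) k : isS1 (fun e => P (e 0%N)) ->
  exists c, codes c (fun i => P i /\ i < k).
Proof.
move=> hP; have [c [_ hc]] := codes_not k hP.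
have [|d hd] := @codes_not (fun i => mem i c) k; first by def.
exists d; apply: codes_ext hd => i; rewrite hc; split=> [[h hi]|[h hi]]; last by split=> // -[].
by split=> //; apply: NNPP => h'; apply: h.
Qed.

(** * Bounds on reals and sets of finite measure *)

Implicit Types (U V A B X Y : num M -> Prop).

(* [rle xi (rnat m)] up to a constant change of m, but without the error term,
   so that no limit arguments are needed below. *)
Implicit Types (xi eta zeta : num M -> qrat M -> Prop).

Definition bounded (xi : num M -> qrat M -> Prop) m :=
  forall k q, xi k q -> qp q <= m * (qd q + 1) + qn q.

Definition total (xi : num M -> qrat M -> Prop) := forall k, exists q, xi k q.

Lemma real_total xi : is_real xi -> total xi.
Proof. by move=> [h _] k; have [q [hq _]] := h k; exists q. Qed.

Lemma bounded_rle xi m : bounded xi m -> rle xi (rnat m).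
Proof.
move=> h k q _ /h /leP [c hc] ->; rewrite /qle /qadd /qfrac /=; apply/leP.
exists (c * (k + 1) + (1 + 1) * (qd q + 1)).
have -> : (m * (k + 1) + (1 + 1) * (0 + 1)) * (qd q + 1) + qn q * (0 * k + 0 + k + 1) =
  (m * (qd q + 1) + qn q) * (k + 1) + (1 + 1) * (qd q + 1) by ring.
rewrite hc; ring.
Qed.

(** The k-th approximations are compared with error 2/(k+1), which is at most 2; hence the increase
    of the bound by 2. *)
Lemma bounded_le xi eta m : total eta -> rle xi eta -> bounded eta m -> bounded xi (m + 1 + 1).
Proof.
move=> hy hle hb k [p n d] hx; have [[p' n' d'] hy'] := hy k.
have := hle _ _ _ hx hy'; have /leP := hb _ _ hy'; rewrite /qle /qadd /qfrac /= => -[c hc] /leP [e he].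
(* The denominator (d'+1)(k+1) is cleared, and a term with n' is added on both sides to absorb the
   subtracted part of the approximation to [eta]. *)
apply: (@leq_mulS (d' * k + d' + k)); apply: (@leq_add2r (n' * (k + 1) * (d + 1))); apply/leP.
exists (e + c * (k + 1) * (d + 1) + (1 + 1) * k * (d' + 1) * (d + 1)).
have -> : ((m + 1 + 1) * (d + 1) + n) * (d' * k + d' + k + 1) + n' * (k + 1) * (d + 1) =
  (m * (d' + 1) + n') * (k + 1) * (d + 1) + (1 + 1) * (d' + 1) * (k + 1) * (d + 1)
    + n * (d' * k + d' + k + 1) by ring.
rewrite hc.
have -> : p * (d' * k + d' + k + 1) + n' * (k + 1) * (d + 1) +
  (e + c * (k + 1) * (d + 1) + (1 + 1) * k * (d' + 1) * (d + 1)) =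
  (p * (d' * k + d' + k + 1) + (n' * (k + 1) + 0 * (d' + 1)) * (d + 1) + e) +
  (c * (k + 1) * (d + 1) + (1 + 1) * k * (d' + 1) * (d + 1)) by ring.
rewrite -he; ring.
Qed.

Lemma rnat_total m : total (rnat m).
Proof. by move=> k; exists (qfrac m 0). Qed.

Lemma rle_bounded xi m : rle xi (rnat m) -> bounded xi (m + 1 + 1).
Proof.
move=> h; apply: bounded_le h _; first exact: rnat_total.
by move=> k _ -> /=; right; ring.
Qed.

Lemma bounded_add zeta xi eta m n : total xi -> total eta -> rle zeta (radd xi eta) ->
  bounded xi m -> bounded eta n -> bounded zeta (m + n + 1 + 1).
Proof.
move=> tx ty hz hx hy; apply: bounded_le hz _.
  move=> k; have [q hq] := tx (k + k + 1); have [r hr] := ty (k + k + 1).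
  by exists (qadd q r), q, r.
move=> k _ [q [r [/hx /leP [a ha] [/hy /leP [b hb] ->]]]] /=; apply/leP.
exists (a * (qd r + 1) + b * (qd q + 1)).
have -> : (m + n) * (qd q * qd r + qd q + qd r + 1) + (qn q * (qd r + 1) + qn r * (qd q + 1)) =
  (m * (qd q + 1) + qn q) * (qd r + 1) + (n * (qd r + 1) + qn r) * (qd q + 1) by ring.
rewrite ha hb; ring.
Qed.

Lemma real_bounded xi : is_real xi -> exists m, bounded xi m.
Proof.
move=> hx; have [[p n d] h0] := real_total hx 0; exists (p + 1) => k [p' n' d'] hk /=.
(* All approximations are within 1 of the 0-th one, which is at most its positive part p. *)
have [_ /leP [e]] := proj2 hx 0 k _ _ (leq0n k) h0 hk; rewrite /= => he.
apply: (@leq_mulS d); apply/leP; exists (e + n * (d' + 1) + p * d * (d' + 1)).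
have -> : p' * (d + 1) + (e + n * (d' + 1) + p * d * (d' + 1)) =
  p' * (d * 0 + d + 0 + 1) + (n * (0 + 1) + 0 * (d + 1)) * (d' + 1) + e + p * d * (d' + 1) by ring.
rewrite -he; ring.
Qed.

Lemma rle_refl xi : is_real xi -> rle xi xi.
Proof.
move=> [hx _] k q r hq hr; have [s [_ hs]] := hx k.
rewrite -(hs _ hq) -(hs _ hr); apply/leP; exists ((1 + 1) * (qd s + 1) * (qd s + 1)).
rewrite /=; ring.
Qed.

Definition subset_code c A := is_fin c /\ forall i, mem i c -> A i.

(** Bounds all finite subsets instead of the initial segments of A; in this form smallness passes to
    subsets with the same bound. *)
Definition small U A := exists m, forall c, subset_code c A -> bounded (value U c) m.

Lemma set_s1 A : sets A -> isS1 (fun e => A (e 0%N)).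
Proof. by move=> sA; def. Qed.

Lemma sub_bounded U x z m : submeasure U -> is_fin x -> is_fin z ->
  (forall i, mem i x -> mem i z) -> bounded (value U z) m -> bounded (value U x) (m + 1 + 1).
Proof.
move=> [hr _ hm _] hx hz hxz; apply: bounded_le; first exact: real_total (hr _ hz).
have [] // := hm x z z hx hz; split=> // i; split=> [|[/hxz|]] //; by right.
Qed.

Lemma union_bounded U x y z m n : submeasure U -> is_fin x -> is_fin y ->
  codes z (fun i => mem i x \/ mem i y) -> bounded (value U x) m -> bounded (value U y) n ->
  bounded (value U z) (m + n + 1 + 1).
Proof.
move=> [hr _ _ ha] hx hy hz; apply: bounded_add (ha _ _ _ hx hy hz).
- exact: real_total (hr _ hx).
- exact: real_total (hr _ hy).
Qed.

Lemma finite_small U A : sets A -> submeasure U -> (finite_measure U A <-> small U A).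
Proof.
move=> sA hU; split=> [[m h]|[m h]].
  (* Two units come from passing from [rle] to [bounded], two from monotonicity of the submeasure.
     The subset c lies in the initial segment of length c. *)
  exists (m + 1 + 1 + 1 + 1) => c [hc hcA].
  have [c' hc'] := bounded_codes c (set_s1 sA).
  apply: (@sub_bounded U c c') => //; first by case: hc'.
    by move=> i hi; apply/(proj2 hc'); split; [apply: hcA | apply: mem_lt].
  by apply: rle_bounded; apply: (h c).
exists m => n c [hc hcA]; apply: bounded_rle; apply: h; split=> // i.
by move/hcA=> [].
Qed.

Lemma finite_code l : exists c, codes c (fun i => i < l).
Proof.
have [|c hc] := @bounded_codes (fun i => i = i) l; first by def.
by exists c; apply: codes_ext hc => i; split=> [[]|].
Qed.

Lemma codes_sub c P : isS1 (fun e => P (e 0%N)) -> exists c', codes c' (fun i => mem i c /\ P i).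
Proof.
move=> /s1_subst1 hP.
have [|d hd] := @bounded_codes (fun i => mem i c /\ P i) c; first by def.
exists d; apply: codes_ext hd => i; split=> [[]//|h]; split=> //; apply: mem_lt; exact: (proj1 h).
Qed.

(** A finite subset of A splits into a part inside B and a part below l, and the latter is
    controlled by the measure of all numbers below l. Hence cutting a reservoir below l keeps its
    measure infinite. *)
Lemma small_tail U A B l : submeasure U -> sets B ->
  (forall i, A i -> B i \/ i < l) -> small U B -> small U A.
Proof.
move=> hU sB hAB [m hm]; have [L hL] := finite_code l.
have [n hn] := real_bounded (let: And4 h _ _ _ := hU in h _ (proj1 hL)).
exists (m + (n + 1 + 1) + 1 + 1) => c [hc hcA].
have [c1 hc1] := codes_sub c (set_s1 sB).
have [|c2 hc2] := @codes_sub c (fun i => i < l); first by def.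
apply: (union_bounded hU (proj1 hc1) (proj1 hc2)).
- split=> // i; split=> [hi|].
    by case: (hAB i (hcA i hi)) => h; [left; apply/(proj2 hc1) | right; apply/(proj2 hc2)].
  by case=> [/(proj2 hc1) []|/(proj2 hc2) []].
- by apply: hm; split=> [|i /(proj2 hc1) []//]; case: hc1.
- apply: (sub_bounded hU (proj1 hc2) (proj1 hL)) hn => i /(proj2 hc2) [_ hi].
  exact/(proj2 hL).
Qed.

Lemma small_measure_le U V A : submeasure U -> submeasure_le V U -> small U A -> small V A.
Proof.
move=> [hU _ _ _] hVU [m hm]; exists (m + 1 + 1) => c hc.
apply: bounded_le (hm c hc); first exact: real_total (hU _ (proj1 hc)).
exact: hVU (proj1 hc).
Qed.

Lemma not_small U A m : ~ small U A -> exists c, subset_code c A /\ ~ bounded (value U c) m.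
Proof.
move=> h; apply: NNPP => h'; apply: h; exists m => c hc.
by apply: NNPP => hb; apply: h'; exists c.
Qed.

(** When a is contained in A, these are the initial segments of sets lying between a and A. *)
Definition compat a A t := exists l s,
  [/\ t = pair l s, is_fin s, forall i, mem i s -> i < l /\ A i
    & forall i, i < l -> mem i a -> mem i s].

Lemma f_compat (b : bool) u v (A : (nat -> num M -> Prop) -> num M -> Prop) : isTm u -> isSt A -> isTm v ->
  isF b (fun e S => compat (u e) (A S) (v e)).
Proof.
move=> hu hA hv; apply: (@f_iff _ _ (fun e S => exists l, l < v e + 1 /\ exists s, s < v e + 1 /\
  (v e = pair l s /\ is_fin s /\ (forall i, i < s -> mem i s -> i < l /\ A S i) /\
   (forall i, i < l -> mem i (u e) -> mem i s)))); last by def.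
move=> e S; split=> [[l [s [h1 h2 h3 h4]]]|[l [_ [s [_ [h1 [h2 [h3 h4]]]]]]]]; last first.
  by exists l, s; split=> // i hi; apply: h3 => //; apply: mem_lt.
exists l; split; first by apply/ltnS; rewrite h1; apply: leq_pair_l.
exists s; split; first by apply/ltnS; rewrite h1; apply: leq_pair_r.
by split=> //; split=> //; split=> // i _; apply: h3.
Qed.
Hint Extern 1 (isF _ (fun e S => compat _ _ _)) =>
  eapply f_compat; [def_tm | first [exact: st_var | apply: st_const; assumption] | def_tm] : definable.

Lemma f_string_ext (b : bool) u v : isTm u -> isTm v -> isF b (fun e S => string_ext (u e) (v e)).
Proof.
move=> hu hv; apply: (@f_iff _ _ (fun e S =>
  exists l, l < u e + 1 /\ exists s, s < u e + 1 /\
  exists l', l' < v e + 1 /\ exists s', s' < v e + 1 /\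
  (u e = pair l s /\ v e = pair l' s' /\ l <= l' /\ is_fin s /\ is_fin s' /\
   (forall i, i < s -> mem i s -> i < l) /\ (forall i, i < s' -> mem i s' -> i < l') /\
   (forall i, i < l -> (mem i s <-> mem i s'))))); last by def.
move=> e _; split=> [[[l0 [s0 [h1 [h2 h3]]]] [[l0' [s0' [h1' [h2' h3']]]]
    [l [s [l' [s' [hu1 [hv1 [hl h]]]]]]]]]|].
  move: h1 h1' h2 h2' h3 h3'; rewrite hu1 hv1 => /pair_inj [<- <-] /pair_inj [<- <-] h2 h2' h3 h3'.
  exists l; split; first by apply/ltnS; apply: leq_pair_l.
  exists s; split; first by apply/ltnS; apply: leq_pair_r.
  exists l'; split; first by apply/ltnS; apply: leq_pair_l.
  exists s'; split; first by apply/ltnS; apply: leq_pair_r.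
  by do !split=> //; move=> *; auto.
move=> [l [_ [s [_ [l' [_ [s' [_ [h1 [h2 [h3 [h4 [h5 [h6 [h7 h8]]]]]]]]]]]]]]].
split; first by exists l, s; split=> //; split=> // i hi; apply: h6 => //; apply: mem_lt.
split; first by exists l', s'; split=> //; split=> // i hi; apply: h7 => //; apply: mem_lt.
by exists l, s, l', s'.
Qed.
Hint Extern 1 (isF _ (fun e S => string_ext _ _)) => apply: f_string_ext; def_tm : definable.

Lemma string_extE l s l' s' : string_ext (pair l s) (pair l' s') <->
  [/\ is_string (pair l s), is_string (pair l' s'), l <= l'
    & forall i, i < l -> (mem i s <-> mem i s')].
Proof.
split=> [[h1 [h2 [k [t [k' [t' [/pair_inj [<- <-] [/pair_inj [<- <-] []]]]]]]]]|[h1 h2 h3 h4]] //.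
by split=> //; split=> //; exists l, s, l', s'.
Qed.

Lemma string_ext_trans x y z : string_ext x y -> string_ext y z -> string_ext x z.
Proof.
move=> [hx [hy [l [s [l' [s' [hxE [hyE [hl h]]]]]]]]] [_ [hz [k [t [k' [t' [hyE' [hzE [hk h']]]]]]]]].
move: hyE' h' hk; rewrite hyE => /pair_inj [<- <-] h' hk.
split=> //; split=> //; exists l, s, k', t'; split=> //; split=> //.
split=> [|i hi]; first exact: leq_trans hl hk.
by rewrite h // h' //; apply: lt_leq_trans hi hl.
Qed.

Lemma string_ext_refl x : is_string x -> string_ext x x.
Proof. by move=> h; move: (h) => [l [s [hE _]]]; split=> //; split=> //; exists l, s, l, s; do !split=> //; right. Qed.

Lemma compat_string a A t : compat a A t -> is_string t.
Proof. by move=> [l [s [-> h1 h2 h3]]]; exists l, s; split=> //; split=> // i /h2 []. Qed.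

Lemma compat_sub a A a' A' t : (forall i, mem i a -> mem i a') -> (forall i, A' i -> A i) ->
  compat a' A' t -> compat a A t.
Proof.
move=> ha hA [l [s [-> h1 h2 h3]]]; exists l, s; split=> // [i /h2 [? /hA]//|i hi /ha].
exact: h3.
Qed.

Lemma compat_stem a A l : (forall i, mem i a -> A i) -> exists s, compat a A (pair l s).
Proof.
move=> h; have [|s [hs hs']] := @codes_sub a (fun i => i < l); first by def.
exists s, l, s; split=> // i; first by move=> /hs' [/h].
by move=> hi ha; apply/hs'.
Qed.

(** * Restriction of conditions and dense families of strings *)

Implicit Types (p q r : triple M) (W : num M -> Prop).

(** Submeasures are compared only through their small sets. This relation is transitive by
    composition, whereas transitivity of [rle], with its error terms, would call for a limit
    argument. *)
Definition weak_ext q p :=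
  [/\ forall i, mem i (stem p) -> mem i (stem q), forall i, mem i (stem q) -> reservoir p i,
      forall i, reservoir q i -> reservoir p i
    & forall A, sets A -> small (measure p) A -> small (measure q) A].

Lemma weak_ext_trans q p r : weak_ext r q -> weak_ext q p -> weak_ext r p.
Proof. by move=> [h1 h2 h3 h4] [k1 k2 k3 k4]; split=> *; auto. Qed.

Lemma weak_ext_refl p : condition p -> weak_ext p p.
Proof. by move=> [_ _ h _ _]; split. Qed.

Lemma extends_weak q p : condition p -> extends q p -> weak_ext q p.
Proof.
move=> [_ _ _ [_ hU] _] [h1 h2 h3 h4]; split=> // A sA.
exact: small_measure_le.
Qed.

Lemma condition_not_small p : condition p -> ~ small (measure p) (reservoir p).
Proof. by move=> [_ sA _ [_ hU] hi] /(finite_small sA hU). Qed.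

Lemma sets_union_tail c A l : sets A -> exists B, sets B /\ forall i, B i <-> mem i c \/ (A i /\ ~ i < l).
Proof.
move=> sA; have [||B hB] := @s1_comprehension (fun i => mem i c \/ (A i /\ ~ i < l)).
- by def.
- by apply: s1_f; def.
by exists B.
Qed.

(** The old stem may reach beyond l, so it is joined to s; the reservoir loses only elements below
    l, hence keeps infinite measure by [small_tail]. *)
Lemma restrict p l s : condition p -> compat (stem p) (reservoir p) (pair l s) ->
  exists q, [/\ condition q, extends q p,
    forall i, mem i (stem q) <-> mem i s \/ mem i (stem p)
    & forall i, reservoir q i <-> mem i (stem q) \/ (reservoir p i /\ ~ i < l)].
Proof.
move=> hp [l' [s' [/pair_inj [<- <-] hs hsA hsa]]].
have [ha sA haA [sU hU] hinf] := hp.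
have [|c hc] := @bounded_codes (fun i => mem i s \/ mem i (stem p)) (s + stem p); first by def.
have {hc} [hc hcE] : codes c (fun i => mem i s \/ mem i (stem p)).
  apply: codes_ext hc => i; split=> [[]//|h]; split=> //.
  by case: h => /mem_lt h; apply: lt_leq_trans h _; [apply: leq_addr | apply: leq_addl].
have hcA i : mem i c -> reservoir p i by case/hcE => [/hsA []|/haA].
have [B [sB hB]] := sets_union_tail c l sA.
exists (Triple c B (measure p)); split=> //=.
  split=> //= [i hi|]; first by apply/hB; left.
  move=> /(finite_small sB hU) hsm; apply: (condition_not_small hp).
  apply: (@small_tail _ _ B l) hsm => // i hi.
  by case: (classic (i < l)) => h; [right | left; apply/hB; right].
split=> //= [i hi|i /hB [/hcA//|[]//]|x hx]; first by apply/hcE; right.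
by apply: rle_refl; case: hU => + _ _ _; apply.
Qed.

(** Below l, both the new stem and the new reservoir consist of the elements of s, so a longer
    compatible string has no freedom there. *)
Lemma restrict_compat p q l s l' s' : compat (stem p) (reservoir p) (pair l s) ->
  (forall i, mem i (stem q) <-> mem i s \/ mem i (stem p)) ->
  (forall i, reservoir q i <-> mem i (stem q) \/ (reservoir p i /\ ~ i < l)) ->
  compat (stem q) (reservoir q) (pair l' s') -> l <= l' ->
  string_ext (pair l s) (pair l' s').
Proof.
move=> hs hq hB hs' hl; apply/string_extE; split=> //.
- exact: compat_string hs.
- exact: compat_string hs'.
move: hs hs' => [? [? [/pair_inj [<- <-] _ h1 h2]]] [? [? [/pair_inj [<- <-] _ h3 h4]]] i hi.
split=> h; first by apply: h4; [apply: lt_leq_trans hl | apply/hq; left].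
have [_ /hB [/hq [//|]|[]//]] := h3 i h; exact: h2.
Qed.

Definition monotone W := forall t t', W t -> string_ext t t' -> W t'.

Definition dense_below p W := forall q, condition q -> weak_ext q p ->
  exists t, compat (stem q) (reservoir q) t /\ W t.

Lemma dense_weak p q W : weak_ext q p -> dense_below p W -> dense_below q W.
Proof. by move=> hqp h r hr hrq; apply: h => //; apply: weak_ext_trans hqp. Qed.

Lemma extend_string p l s k : condition p -> compat (stem p) (reservoir p) (pair l s) ->
  exists l' s', [/\ compat (stem p) (reservoir p) (pair l' s'),
    string_ext (pair l s) (pair l' s') & k <= l'].
Proof.
move=> hp hs; have [q [hq hqp h1 h2]] := restrict hp hs.
have [s' hs'] := compat_stem (l + k) (let: And5 _ _ h _ _ := hq in h).
exists (l + k), s'; split; last exact: leq_addl.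
  by have [? _ ? _] := hqp; apply: compat_sub hs'.
by apply: (restrict_compat hs h1 h2 hs'); apply: leq_addr.
Qed.

(** Restricting to s first makes long compatible strings extend s. The string supplied by density
    may be shorter than l, so it is lengthened; monotonicity keeps it in W. *)
Lemma dense_extend p W q l s k : monotone W -> dense_below p W -> condition q -> weak_ext q p ->
  compat (stem q) (reservoir q) (pair l s) -> exists l' s',
  [/\ compat (stem q) (reservoir q) (pair l' s'), string_ext (pair l s) (pair l' s'), k <= l'
    & W (pair l' s')].
Proof.
move=> hW hd hq hqp hs; have [r [hr hrq h1 h2]] := restrict hq hs.
have [t [ht hWt]] := hd r hr (weak_ext_trans (extends_weak hq hrq) hqp).
move: (ht) => [l1 [s1 [tE _ _ _]]]; rewrite tE in ht hWt.
have [l' [s' [hs' hext hk]]] := extend_string (l + k) hr ht.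
have [? _ ? _] := hrq; exists l', s'; split.
- exact: compat_sub hs'.
- by apply: (restrict_compat hs h1 h2 hs'); apply: leq_trans hk; apply: leq_addr.
- by apply: leq_trans hk; apply: leq_addl.
- exact: hW hext.
Qed.

Lemma dense_and p W W' : monotone W -> monotone W' -> dense_below p W -> dense_below p W' ->
  dense_below p (fun t => W t /\ W' t).
Proof.
move=> hW hW' h h' q hq hqp; have [t [ht hWt]] := h q hq hqp.
move: (ht) => [l [s [htE _ _ _]]]; rewrite htE in ht hWt.
have [l' [s' [hs' hext _ hWt']]] := dense_extend 0 hW' h' hq hqp ht.
by exists (pair l' s'); do !split=> //; apply: hW hext.
Qed.

(** The W x are met one after another by lengthening a string. Existence of a compatible string
    meeting all W x with x < j is Sigma^0_1 in j, so induction reaches nonstandard k. *)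
Lemma dense_ball p (W : num M -> num M -> Prop) k :
  isS1 (fun e => W (e 0%N) (e 1%N)) -> (forall x, monotone (W x)) ->
  (forall x, x < k -> dense_below p (W x)) -> dense_below p (fun t => forall x, x < k -> W x t).
Proof.
move=> /s1_subst2 hW hm hd q hq hqp.
have [ha sA haA _ _] := hq.
suff /(_ k) [t [ht h]] : forall j, exists t, compat (stem q) (reservoir q) t /\
    forall x, x < j -> x < k -> W x t by exists t; split=> // x hx; apply: h.
apply: s1_ind => [||j [t [ht h]]]; first by def.
  by have [s hs] := compat_stem 0 haA; exists (pair 0 s); split=> // x /ltn0.
case: (classic (j < k)) => hj; last by exists t; split=> // x /ltnS [/h//|->].
move: (ht) => [l [s [htE _ _ _]]]; rewrite htE in ht h.
have [l' [s' [hs' hext _ hWt']]] := dense_extend 0 (hm j) (hd j hj) hq hqp ht.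
exists (pair l' s'); split=> // x /ltnS [hx hk|->//]; exact: hm (h x hx hk) hext.
Qed.

Lemma local_dense (F : relation M 1) p x : condition p -> local F p ->
  dense_below p (fun t => exists y, F t [tuple x] y).
Proof.
move=> hp hF q hq [h1 h2 h3 h4].
have [_ _ _ [sU hU] _] := hp; have [fq sB hqB _ _] := hq.
(* Locality speaks of genuine extensions, so q receives the submeasure of p, for which its reservoir
   still is not small. *)
have [||X [[sX hX hXB _] [_ hd]]] := hF (Triple (stem q) (reservoir q) (measure p)).
- split=> //= /(finite_small sB hU) /(h4 _ sB); exact: condition_not_small.
- by split=> // c hc; apply: rle_refl; case: hU => + _ _ _; apply.
have [t [y [[n [s [tE [hs hsX]]]] hy]]] := hd [tuple x].
exists t; split; last by exists y.
exists n, s; split=> // i; first by move/hsX => [/hXB].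
by move=> hi /hX hXi; apply/hsX.
Qed.

(** * Recursion, and ground-model sets meeting a dense family *)

Lemma recursion (R : num M -> num M -> num M -> Prop) v0 :
  (forall t u v, isTm t -> isTm u -> isTm v -> isF false (fun e S => R (t e) (u e) (v e))) ->
  (forall n v, exists v', R n v v') ->
  exists H : num M -> num M -> Prop,
    [/\ isS1 (fun e => H (e 0%N) (e 1%N)), H 0 v0, forall n, exists v, H n v,
        forall n v v', H n v -> H (n + 1) v' -> R n v v'
      & forall n v v', H n v -> H n v' -> v = v'].
Proof.
move=> hR htot.
(* The least admissible value makes the step relation functional. *)
pose Rm n v v' := R n v v' /\ forall u, u < v' -> ~ R n v u.
have Rm_tot n v : exists v', Rm n v v'.
  have [v' hv'] := htot n v; apply: (@least (R n v) v') => //.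
  by apply: s1_f; apply: hR; def.
have Rm_fun n v u u' : Rm n v u -> Rm n v u' -> u = u'.
  move=> [h1 h2] [h1' h2']; apply: NNPP => /lt_total [/h2' hn|/h2 hn]; exact: hn.
(* A history is a coded set of pairs (stage, value) in which each entry up to stage N is justified
   by one of the previous stage. Uniqueness of values is not imposed but follows by induction on the
   stage. *)
pose Hist h N := (forall u, u < h -> mem (pair 0 u) h -> u = v0) /\
  forall n, n < N -> forall u, u < h -> mem (pair (n + 1) u) h ->
  exists u', u' < h /\ (mem (pair n u') h /\ Rm n u' u).
have in_lt n u h : mem (pair n u) h -> u < h.
  by move=> /mem_lt; apply: leq_lt_trans (leq_pair_r _ _).
pose H n v := exists h, Hist h n /\ mem (pair n v) h.
have hH : isS1 (fun e => H (e 0%N) (e 1%N)) by rewrite /H /Hist /Rm; def.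
have hH2 := s1_subst2 hH.
have H_fun n v v' : H n v -> H n v' -> v = v'.
  move=> [h [[h0 hS] hv]] [h' [[h0' hS'] hv']].
  suff hind k : k <= n -> forall u, u < h -> mem (pair k u) h ->
      forall u', u' < h' -> mem (pair k u') h' -> u = u'.
    by apply: (hind n (leqnn n)) => //; apply: in_lt; eassumption.
  elim/d0_ind: k => [|_ u hu hm u' hu' hm'|k IH hk u hu hm u' hu' hm']; first by def.
    by rewrite (h0 u) // (h0' u').
  have hkn : k < n by apply/ltle.
  have [w [hw [hmw hRw]]] := hS k hkn u hu hm.
  have [w' [hw' [hmw' hRw']]] := hS' k hkn u' hu' hm'.
  move: hRw; rewrite (IH (leqw hkn) w hw hmw w' hw' hmw') => hRw; exact: Rm_fun hRw hRw'.
have H0 : H 0 v0.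
  have [|h [_ hh]] := @bounded_codes (fun c => c = pair 0 v0) (pair 0 v0 + 1); first by def.
  exists h; split; last by apply/hh; split=> //; apply: ltnSn.
  by split=> [u _ /hh [/pair_inj []]//|n /ltn0].
have H_step n v v' : H n v -> Rm n v v' -> H (n + 1) v'.
  move=> [h [[h0 hS] hv]] hRv.
  (* Entries of h beyond stage n are unconstrained; they are dropped before the new pair is
     added. *)
  have [|h' [_ hh]] := @bounded_codes (fun c => (mem c h /\ exists k, k < n + 1 /\
    exists u, u < h /\ c = pair k u) \/ c = pair (n + 1) v') (h + (pair (n + 1) v') + 1).
    by def.
  have {}hh k u : mem (pair k u) h' <->
      (mem (pair k u) h /\ k <= n) \/ (k = n + 1 /\ u = v').
    rewrite hh; split=> [[[[hm [k' [hk' [u' [hu' /pair_inj [kE _]]]]]]|/pair_inj [-> ->]] _]|].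
    - by left; split=> //; rewrite kE; apply/ltnS.
    - by right.
    case=> [[hm hk]|[-> ->]]; split.
    - left; split=> //; exists k; split; first exact/ltnS.
      by exists u; split=> //; apply: in_lt hm.
    - by apply: lt_trans (mem_lt hm) _; apply: lt_addS_l.
    - by right.
    - exact: lt_addS_r.
  exists h'; split; last by apply/hh; right.
  split=> [u _ /hh [[hm _]|[h1 _]]|k hk u _ /hh [[hm hkn]|[/succ_inj -> ->]]].
  - by apply: h0 => //; apply: in_lt hm.
  - by case: (@succ_neq0 n).
  - have [u' [hu' [hm' hR']]] := hS k (proj2 (ltle _ _) hkn) u (in_lt _ _ _ hm) hm.
    have hm2 : mem (pair k u') h' by apply/hh; left; split=> //; apply/ltnS.
    by exists u'; split; [apply: in_lt hm2 | ].
  - have hm2 : mem (pair n v) h' by apply/hh; left; split=> //; right.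
    by exists v; split; [apply: in_lt hm2 | ].
exists H; split=> // [n|n v v' hv [h [[h0 hS] hv']]].
  move: n; apply: s1_ind => [||n [v hv]]; first by def.
    by exists v0.
  by have [v' hv'] := Rm_tot n v; exists v'; apply: H_step hv'.
have [u [hu [hm [hRu _]]]] := hS n (ltnSn n) v' (in_lt _ _ _ hv') hv'.
rewrite (H_fun n v u) //; exists h; split=> //; split=> // k hk.
by apply: hS; apply: lt_trans hk (ltnSn n).
Qed.

Lemma s1_witness (V : num M -> num M -> Prop) : isS1 (fun e => V (e 0%N) (e 1%N)) ->
  exists V0 : num M -> num M -> num M -> Prop,
    (forall n x, V n x <-> exists w, V0 n x w) /\
    forall t u v, isTm t -> isTm u -> isTm v -> isF false (fun e S => V0 (t e) (u e) (v e)).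
Proof.
move=> [Q hQ h]; exists (fun n x w => Q (scons w (scons n (fun _ => x)))); split=> [n x|t u v ht hu hv].
  exact: (h (scons n (fun _ => x))).
pose s := scons v (scons t (fun _ : nat => u)).
have hs i : isTm (s i) by case: i => [|[|i]].
apply: f_iff (f_subst hQ hs) => e S.
by apply: iff_of_eq; congr Q; apply: functional_extensionality => -[|[|]].
Qed.

Lemma dense_branch p (V : num M -> num M -> Prop) q :
  isS1 (fun e => V (e 0%N) (e 1%N)) -> (forall n, monotone (V n)) ->
  (forall n, dense_below p (V n)) -> condition q -> weak_ext q p ->
  exists X, [/\ sets X, forall i, mem i (stem q) -> X i, forall i, X i -> reservoir q i
    & forall n, exists t, initial_segment t X /\ V n t].
Proof.
move=> /s1_witness [V0 [hV0 hdV0]] hmon hd hq hqp.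
have [ha sA haA _ _] := hq.
pose C l s := compat (stem q) (reservoir q) (pair l s).
have hC t u : isTm t -> isTm u -> isF false (fun e S => C (t e) (u e)).
  by move=> ht hu; rewrite /C; def.
(* A value codes a compatible string (l, s) with a witness w of the last Sigma^0_1 fact met, which
   keeps R Delta^0_0. On values of any other form R imposes nothing, so R is total. *)
pose R n v v' := forall l, l < v + 1 -> forall s, s < v + 1 -> forall w, w < v + 1 ->
  v = pair (pair l s) w -> C l s ->
  exists l', l' < v' + 1 /\ exists s', s' < v' + 1 /\ exists w', w' < v' + 1 /\
  (v' = pair (pair l' s') w' /\ C l' s' /\ string_ext (pair l s) (pair l' s') /\
   n < l' /\ V0 n (pair l' s') w').
have bnd l s w : [/\ l < pair (pair l s) w + 1, s < pair (pair l s) w + 1 & w < pair (pair l s) w + 1].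
  split; apply/ltnS; [| | exact: leq_pair_r]; apply: leq_trans (leq_pair_l _ _).
    exact: leq_pair_l.
  exact: leq_pair_r.
have [s0 hs0] := compat_stem 0 haA.
have [|n v|H [hH H0 Htot HS Hfun]] := @recursion R (pair (pair 0 s0) 0).
- by move=> t u v ht hu hv; rewrite /R; def.
- case: (classic (exists l s w, v = pair (pair l s) w /\ C l s)) => [[l [s [w [-> hls]]]]|hno]; last first.
    by exists 0 => l _ s _ w _ hv hls; case: hno; exists l, s, w.
  have [l' [s' [hs' hext hl /hV0 [w' hw']]]] := dense_extend (n + 1) (hmon n) (hd n) hq hqp hls.
  exists (pair (pair l' s') w') => l1 _ s1 _ w1 _ /pair_inj [/pair_inj [<- <-] _] _.
  have [b1 b2 b3] := bnd l' s' w'.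
  exists l'; split=> //; exists s'; split=> //; exists w'; do !split=> //.
  exact/ltle.
have hH2 := s1_subst2 hH.
pose T n l s := C l s /\ exists w, H n (pair (pair l s) w).
have hT t u v : isTm t -> isTm u -> isTm v -> isS1 (fun e => T (t e) (u e) (v e)).
  by move=> ht hu hv; rewrite /T; def.
have T_step n l s l' s' : T n l s -> T (n + 1) l' s' ->
    [/\ string_ext (pair l s) (pair l' s'), n < l' & V n (pair l' s')].
  move=> [hls [w hw]] [_ [w' hw']]; have [b1 b2 b3] := bnd l s w.
  have [l1 [_ [s1 [_ [w1 [_ [/pair_inj [/pair_inj [<- <-] _] [_ [h1 [h2 h3]]]]]]]]]] :=
    HS n _ _ hw hw' l b1 s b2 w b3 erefl hls.
  by split=> //; apply/hV0; exists w1.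
have T_tot n : exists l s, T n l s.
  move: n; apply: s1_ind => [||n [l [s [hls [w hw]]]]]; first by def.
    by exists 0, s0; split=> //; exists 0.
  have [v' hv'] := Htot (n + 1); have [b1 b2 b3] := bnd l s w.
  have [l1 [_ [s1 [_ [w1 [_ [hE [h0 _]]]]]]]] := HS n _ _ hw hv' l b1 s b2 w b3 erefl hls.
  by exists l1, s1; split=> //; exists w1; rewrite -hE.
have T_fun n l s l' s' : T n l s -> T n l' s' -> l = l' /\ s = s'.
  by move=> [_ [w hw]] [_ [w' hw']]; have [/pair_inj] := pair_inj (Hfun _ _ _ hw hw').
have T_mono n k l s l' s' : T n l s -> T (n + k) l' s' -> string_ext (pair l s) (pair l' s').
  move=> hls.
  suff [l1 [s1 [h1 h2]]] : exists l1 s1, T (n + k) l1 s1 /\ string_ext (pair l s) (pair l1 s1).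
    by move=> /(T_fun _ _ _ _ _ h1) [<- <-].
  move: k; apply: s1_ind => [||k [l1 [s1 [h1 h2]]]]; first by def.
    exists l, s; rewrite addn0; split=> //; apply: string_ext_refl; exact: compat_string (proj1 hls).
  have [l2 [s2 hls2]] := T_tot (n + (k + 1)).
  exists l2, s2; split=> //; apply: string_ext_trans h2 _.
  by move: hls2; rewrite addnA => /(T_step _ _ _ _ _ h1) [].
have T_agree n m l s l' s' i : T n l s -> T m l' s' -> i < l -> i < l' -> (mem i s <-> mem i s').
  move=> h h' hi hi'; case: (leq_total n m) => /leP [k hk].
    by rewrite hk in h'; have /string_extE [_ _ _ he] := T_mono _ _ _ _ _ _ h h'; apply: he.
  by rewrite hk in h; have /string_extE [_ _ _ he] := T_mono _ _ _ _ _ _ h' h; rewrite he.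
have T_long i : exists n l s, T n l s /\ i < l.
  have [l [s h]] := T_tot i; have [l' [s' h']] := T_tot (i + 1).
  by exists (i + 1), l', s'; split=> //; have [] := T_step _ _ _ _ _ h h'.
pose P i := exists n l s, T n l s /\ i < l /\ mem i s.
have PE n l s i : T n l s -> i < l -> (P i <-> mem i s).
  move=> h hi; split=> [[n' [l' [s' [h' [hi' hm]]]]]|hm]; last by exists n, l, s.
  by rewrite (T_agree _ _ _ _ _ _ i h h').
(* The strings cohere and their lengths are unbounded, so non-membership of i is also Sigma^0_1:
   some string longer than i omits it. *)
have [||X [sX hX]] := @s1_comprehension P.
- by rewrite /P; def.
- apply: (@s1_iff _ (fun e => exists n l s, T n l s /\ e 0%N < l /\ ~ mem (e 0%N) s)); last by def.
  move=> e; have [n [l [s [h hi]]]] := T_long (e 0%N).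
  split=> [hP|[n' [l' [s' [h' [hi' hm]]]]]]; last by rewrite (PE _ _ _ _ h' hi').
  by exists n, l, s; split=> //; split=> //; rewrite -(PE _ _ _ _ h hi).
exists X; split=> // [i hi|i /hX|n].
- apply/hX; have [n [l [s [h hil]]]] := T_long i; apply/(PE _ _ _ _ h hil).
  by case: h => [[l1 [s1 [/pair_inj [<- <-] _ _ h1]]] _]; apply: h1.
- move=> [n [l [s [[[l1 [s1 [/pair_inj [<- <-] _ h1 _]]] _] [hi hm]]]]].
  by have [] := h1 i hm.
have [l [s h]] := T_tot n; have [l' [s' h']] := T_tot (n + 1).
have [_ _ hV] := T_step _ _ _ _ _ h h'.
exists (pair l' s'); split=> //; exists l', s'; split=> //.
have [[l1 [s1 [/pair_inj [<- <-] hs h1 _]]] _] := h'.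
split=> // i; rewrite hX; split=> [hm|[hP hi]]; last by apply/(PE _ _ _ _ h').
by have [hi _] := h1 i hm; split=> //; apply/(PE _ _ _ _ h').
Qed.

Lemma boundedE U c m : bounded (value U c) m <->
  forall k x y z, U (pair (pair c k) (pair (pair x y) z)) -> x <= m * (z + 1) + y.
Proof. by split=> [h k x y z /(h k (QRat x y z))|h k [x y z] /h]. Qed.

Lemma f_small (A U : (nat -> num M -> Prop) -> num M -> Prop) :
  isSt A -> isSt U -> isF true (fun e S => small (U S) (A S)).
Proof.
move=> hA hU; apply: (@f_iff _ _ (fun e S => exists m, forall c,
  is_fin c /\ (forall i, mem i c -> A S i) -> forall k x y z,
  U S (pair (pair c k) (pair (pair x y) z)) -> x <= m * (z + 1) + y)); last by def.
by move=> e S; split=> -[m h]; exists m => c /h /boundedE.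
Qed.
Hint Extern 1 (isF true (fun e S => small _ _)) =>
  eapply f_small; [first [exact: st_var | apply: st_const; assumption]
                  |first [exact: st_var | apply: st_const; assumption]] : definable.

Lemma s1_not_bounded U t u : sets U -> isTm t -> isTm u ->
  isS1 (fun e => ~ bounded (value U (t e)) (u e)).
Proof.
move=> sU ht hu; apply: (@s1_iff _ (fun e => exists k x y z,
  U (pair (pair (t e) k) (pair (pair x y) z)) /\ ~ x <= u e * (z + 1) + y)); last by def.
move=> e; rewrite boundedE; split=> [h|[k [x [y [z [h1 h2]]]]] h]; last exact: h2 (h _ _ _ _ h1).
apply: NNPP => h'; apply: h => k x y z hU; apply: NNPP => hle.
by apply: h'; exists k, x, y, z.
Qed.

Lemma dense_neighborhood p q (W : num M -> num M -> Prop) :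
  isS1 (fun e => W (e 0%N) (e 1%N)) -> (forall n, monotone (W n)) ->
  (forall n, dense_below p (W n)) -> condition q -> weak_ext q p ->
  exists X, neighborhood q X /\ forall n, exists t, initial_segment t X /\ W n t.
Proof.
move=> /s1_subst2 hW hmon hd hq hqp.
(* L n asks that the string contain a finite set whose measure is not bounded by n. A set with
   initial segments in every L n has infinite measure. *)
pose L n t := exists c l s, t = pair l s /\ (is_fin c /\ ((forall i, i < c -> mem i c -> mem i s)
  /\ (~ bounded (value (measure q) c) n /\ forall i, i < s -> mem i s -> i < l))).
have [_ sA haA [sU hU] _] := hq.
have hL : isS1 (fun e => W (e 0%N) (e 1%N) /\ L (e 0%N) (e 1%N)).
  have hb := s1_not_bounded sU; rewrite /L; def.
have Lmon n : monotone (L n).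
  move=> t _ [c [l [s [-> [hc [hcs [hb hsl]]]]]]] [_ [[l' [s' [-> [hs' hsl']]]]
    [l1 [s1 [l1' [s1' [/pair_inj [<- <-] [/pair_inj [<- <-] [hl h]]]]]]]]].
  exists c, l', s'; do !split=> //; last by move=> i _; apply: hsl'.
  by move=> i hi hm; have := hcs i hi hm => hm'; apply/h => //; apply: hsl => //; apply: mem_lt.
have Ldense n : dense_below q (L n).
  move=> r hr [_ _ _ hrq]; have [har sr har' _ _] := hr.
  have [|c [[hc hcA] hb]] := @not_small (measure q) (reservoir r) n.
    by move=> /(hrq _ sr); apply: condition_not_small.
  have [s [hs hsE]] := bounded_codes c (set_s1 sr).
  exists (pair c s); split.
    exists c, s; split=> // i; first by move/hsE => [].
    by move=> hi /har' hri; apply/hsE.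
  exists c, c, s; do !split=> //; last by move=> i _ /hsE [].
  by move=> i hi hm; apply/hsE; split=> //; apply: hcA.
have [||X [sX h1 h2 h3]] :=
  dense_branch (V := fun n t => W n t /\ L n t) hL _ _ hq (weak_ext_refl hq).
- by move=> n t t' [hWt hLt] hext; split; [apply: hmon hWt hext | apply: Lmon hLt hext].
- by move=> n; apply: dense_and => //; apply: dense_weak hqp (hd n).
exists X; split; last by move=> n; have [t [ht [hWt _]]] := h3 n; exists t.
split=> // /(finite_small sX hU) [m hm].
have [t [[n [s [-> [_ hs]]]] [_ [c [l' [s' [/pair_inj [_ <-] [hc [hcs [hb _]]]]]]]]]] := h3 m.
apply: hb; apply: hm; split=> // i hi.
by have /hs [] := hcs i (mem_lt hi) hi.
Qed.

Lemma dense_local (F : relation M 1) p : condition p ->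
  isS1 (fun e => exists y, F (e 1%N) [tuple e 0%N] y) ->
  (forall x, monotone (fun t => exists y, F t [tuple x] y)) ->
  (forall x, dense_below p (fun t => exists y, F t [tuple x] y)) -> local F p.
Proof.
move=> hp hF hmon hd q hq hqp.
have [X [hX h]] := dense_neighborhood (W := fun x t => exists y, F t [tuple x] y)
  hF hmon hd hq (extends_weak hp hqp).
exists X; split=> //; split; first by case: hX.
move=> x; have [t [ht [y hy]]] := h (thead x); exists t, y; split=> //.
by rewrite (tuple1E x).
Qed.

(** * Strings decided by the generic filter *)

Context (GG : triple M -> Prop) (hG : generic_filter GG).
Let G := generic_real GG.

Lemma generic_condition p : GG p -> condition p.
Proof. by have [[h _ _ _] _] := hG; apply: h. Qed.

Lemma generic_common p q : GG p -> GG q -> exists r, [/\ GG r, weak_ext r p & weak_ext r q].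
Proof.
have [[_ _ _ h] _] := hG => hp hq; have [r [hr hrp hrq]] := h _ _ hp hq.
by exists r; split=> //; apply: extends_weak => //; apply: generic_condition.
Qed.

Lemma generic_meets (P : num M -> (num M -> Prop) -> (num M -> Prop) -> Prop) :
  isF true (fun e S => P (e 0%N) (S 0%N) (S 1%N)) ->
  (forall p, condition p -> exists q, condition q /\ extends q p /\
     P (stem q) (reservoir q) (measure q)) ->
  exists p, GG p /\ P (stem p) (reservoir p) (measure p).
Proof.
move=> [phi [d [E [_ hE hP]]]] hd; have [_ gen] := hG.
have [|p hp|p [hp [_ hPp]]] := gen (fun p => condition p /\ P (stem p) (reservoir p) (measure p)).
- split=> [p []//|].
  (* The odd variables are moved behind the components of the condition. Even number variables all
     read the stem; even set variables read the reservoir at 0 and the measure elsewhere. *)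
  pose r i := if odd i then i./2.+1 else 0%N.
  pose s i := if odd i then i./2.+2 else if i is 0 then 0%N else 1%N.
  exists (fren r s phi), d, E; split=> // p hp; rewrite sat_fren.
  have -> : (fun i => scons (stem p) d (r i)) = mix (fun _ => stem p) d.
    by apply: functional_extensionality => i; rewrite /r /mix; case: odd.
  have -> : (fun i => scons (reservoir p) (scons (measure p) E) (s i)) =
            mix (scons (reservoir p) (fun _ => measure p)) E.
    apply: functional_extensionality => i; rewrite /s /mix; case hi: (odd i) => //.
    by have := half_even hi; case: (i./2) => [|j] ->; rewrite ?doubleS.
  by rewrite -hP; split=> [[]|].
- by have [q [hq [hqp hPq]]] := hd p hp; exists q.
by exists p.
Qed.

(** Dual to [compat]: every set between a and A has t as an initial segment. *)
Definition decides a A t := exists l s,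
  [/\ t = pair l s, is_fin s, forall i, mem i s -> i < l /\ mem i a
    & forall i, i < l -> A i -> mem i s].

Lemma f_decides (b : bool) u v (A : (nat -> num M -> Prop) -> num M -> Prop) :
  isTm u -> isSt A -> isTm v -> isF b (fun e S => decides (u e) (A S) (v e)).
Proof.
move=> hu hA hv; apply: (@f_iff _ _ (fun e S => exists l, l < v e + 1 /\ exists s, s < v e + 1 /\
  (v e = pair l s /\ is_fin s /\ (forall i, i < s -> mem i s -> i < l /\ mem i (u e)) /\
   (forall i, i < l -> A S i -> mem i s)))); last by def.
move=> e S; split=> [[l [s [h1 h2 h3 h4]]]|[l [_ [s [_ [h1 [h2 [h3 h4]]]]]]]]; last first.
  by exists l, s; split=> // i hi; apply: h3 => //; apply: mem_lt.
exists l; split; first by apply/ltnS; rewrite h1; apply: leq_pair_l.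
exists s; split; first by apply/ltnS; rewrite h1; apply: leq_pair_r.
by split=> //; split=> //; split=> // i _; apply: h3.
Qed.
Hint Extern 1 (isF _ (fun e S => decides _ _ _)) =>
  eapply f_decides; [def_tm | first [exact: st_var | apply: st_const; assumption] | def_tm] : definable.

(** The last clause carries what happens below q back to strings that extend t and are compatible
    with p, where maximality of t can be invoked. *)
Lemma restrict_decides p t : condition p -> compat (stem p) (reservoir p) t ->
  exists q, [/\ condition q, extends q p, decides (stem q) (reservoir q) t
    & forall t', compat (stem q) (reservoir q) t' -> exists t'',
      [/\ compat (stem p) (reservoir p) t'', string_ext t t'' & string_ext t' t'']].
Proof.
move=> hp ht; have [l [s [tE hs hsl has]]] := ht; rewrite tE in ht *.
have [q [hq hqp h1 h2]] := restrict hp ht; exists q; split=> //.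
  exists l, s; split=> // i; first by move=> hi; have [? _] := hsl i hi; split=> //; apply/h1; left.
  by move=> hi /h2 [/h1 [//|/has]|[]//]; apply.
move=> t' ht'; have [l' [s' [tE' _ _ _]]] := ht'; rewrite tE' in ht' *.
have [l'' [s'' [hs'' hext hl]]] := extend_string l hq ht'.
have [? _ ? _] := hqp; exists (pair l'' s''); split=> //; first exact: compat_sub hs''.
exact: (restrict_compat ht h1 h2 hs'' hl).
Qed.

Lemma generic_subset p i : GG p -> G i -> reservoir p i.
Proof.
move=> hp [q [hq hi]]; have [r [_ [_ h _ _] [h' _ _ _]]] := generic_common hp hq.
by apply: h; apply: h'.
Qed.

Lemma generic_decides p t : GG p -> decides (stem p) (reservoir p) t -> initial_segment t G.
Proof.
move=> hp [l [s [-> hs h1 h2]]]; exists l, s; split=> //; split=> // i; split=> [hi|[hGi hi]].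
  by have [? ?] := h1 i hi; split=> //; exists p.
by apply: h2 => //; apply: generic_subset hGi.
Qed.

Lemma generic_compat p t : GG p -> initial_segment t G -> compat (stem p) (reservoir p) t.
Proof.
move=> hp [l [s [-> [hs h]]]]; exists l, s; split=> // i.
  by move=> /h [hi]; split=> //; apply: generic_subset hi.
by move=> hi hip; apply/h; split=> //; exists p.
Qed.

Lemma segment_string X t : initial_segment t X -> is_string t.
Proof. by move=> [l [s [-> [hs h]]]]; exists l, s; split=> //; split=> // i /h []. Qed.

(* The class of conditions deciding W is dense because a condition either has a
   compatible string in W, to which it can be restricted, or avoids W. *)
Lemma generic_decision W : (forall t, isTm t -> isF true (fun e S => W (t e))) ->
  exists p, GG p /\ ((exists t, decides (stem p) (reservoir p) t /\ W t) \/
                     (forall t, compat (stem p) (reservoir p) t -> ~ W t)).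
Proof.
move=> hW; apply: (@generic_meets (fun a A _ => (exists t, decides a A t /\ W t) \/
  (forall t, compat a A t -> ~ W t))); first by def.
move=> p hp; case: (classic (exists t, compat (stem p) (reservoir p) t /\ W t)) => [[t [ht hWt]]|hn].
  by have [q [hq hqp hqt _]] := restrict_decides hp ht; exists q; do 2!split=> //; left; exists t.
exists p; split=> //; split; last by right=> t ht hWt; apply: hn; exists t.
have [_ _ ha [_ [hU _ _ _]] _] := hp.
by split=> // c hc; apply: rle_refl; apply: hU.
Qed.

Lemma dense_generic p W : (forall t, isTm t -> isF true (fun e S => W (t e))) ->
  GG p -> dense_below p W -> exists t, initial_segment t G /\ W t.
Proof.
move=> hW hp hd; have [q [hq [[t [ht hWt]]|hn]]] := generic_decision hW.
  by exists t; split=> //; apply: generic_decides ht.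
have [r [hr hrp hrq]] := generic_common hp hq.
have [t [ht hWt]] := hd r (generic_condition hr) hrp.
by have [? _ ? _] := hrq; case: (hn t) => //; apply: compat_sub ht.
Qed.

(* As W_n does not mention the measure, quantifying over extensions with the same
   measure and a smaller reservoir is enough to control all stronger conditions. *)
Lemma generic_family (W : num M -> num M -> Prop) :
  isS1 (fun e => W (e 0%N) (e 1%N)) ->
  (forall n, exists t, initial_segment t G /\ W n t) ->
  exists p, GG p /\ forall n, dense_below p (W n).
Proof.
move=> /s1_subst2 hW hGW.
pose P a A U := (exists n, forall t, compat a A t -> ~ W n t) \/
  (forall B, sets B -> (forall i, B i -> A i) -> ~ small U B ->
   forall b, is_fin b -> (forall i, mem i a -> mem i b) -> (forall i, mem i b -> B i) ->
   forall n, exists t, compat b B t /\ W n t).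
have [||p [hp [[n hn]|h]]] := @generic_meets P.
- rewrite /P; def.
- move=> p hp; have [ha sA haA [sU hU] hinf] := hp.
  case: (classic (P (stem p) (reservoir p) (measure p))) => [h|hno].
    exists p; split=> //; split=> //; split=> // c hc; apply: rle_refl.
    by case: hU => + _ _ _; apply.
  have [B [b [n [[sB hBA hB] [hb hab hbB] hn]]]] : exists B b n,
    [/\ [/\ sets B, forall i, B i -> reservoir p i & ~ small (measure p) B],
        [/\ is_fin b, forall i, mem i (stem p) -> mem i b & forall i, mem i b -> B i]
      & forall t, compat b B t -> ~ W n t].
    apply: NNPP => h; apply: hno; right=> B sB hBA hB b hb hab hbB n.
    apply: NNPP => h'; apply: h; exists B, b, n; split=> // t ht hWt; apply: h'.
    by exists t.
  exists (Triple b B (measure p)); split; last split.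
  + by split=> //= /(finite_small sB hU).
  + split=> //= [i /hbB /hBA //|c hc]; apply: rle_refl.
    by case: hU => + _ _ _; apply.
  + by left; exists n.
- have [t [ht hWt]] := hGW n; case: (hn t) => //; exact: generic_compat.
exists p; split=> // n q hq [h1 h2 h3 h4]; have [hb sB hbB _ _] := hq.
by apply: h => // /(h4 _ sB); apply: condition_not_small.
Qed.

Lemma dense_imp p W W' : (forall t, is_string t -> W t -> W' t) ->
  dense_below p W -> dense_below p W'.
Proof.
move=> h hd q hq hqp; have [t [ht hWt]] := hd q hq hqp; exists t; split=> //.
exact: h (compat_string ht) hWt.
Qed.

Lemma dense_true p W : (forall t, W t) -> dense_below p W.
Proof.
by move=> h q [_ _ hq _ _] _; have [s hs] := compat_stem 0 hq; exists (pair 0 s).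
Qed.

(** * Truth in the extension, approximated by strings *)

Lemma relation_s1 (F : relation M 1) t u v : Sigma01_relation F -> isTm t -> isTm u -> isTm v ->
  isS1 (fun e => F (t e) [tuple u e] (v e)).
Proof.
move=> [phi [d [E [hphi hE h]]]] ht hu hv.
pose s := scons t (scons u (scons v (fun j _ => d j))).
have hs i : isTm (s i) by case: i => [|[|[|i]]] //; apply: tm_const.
apply: s1_iff (s1_sat hphi hE hs) => e; rewrite h.
suff -> : foldr (@scons _) d (t e :: rcons [tuple u e] (v e)) = (fun i => s i e) by [].
by apply: functional_extensionality => -[|[|[|i]]].
Qed.

Lemma s1_relation (F : relation M 1) : isS1 (fun e => F (e 0%N) [tuple e 1%N] (e 2%N)) ->
  Sigma01_relation F.
Proof.
move=> hF; have [phi [_ [d [E [[hphi _] hE h _]]]]] := s1_formula 2 hF hF.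
exists (Ex phi), d, E; split=> //; first by exists phi.
move=> t x y; rewrite {1 2}(tuple1E x).
have := h (scons t (scons (thead x) (fun _ => y))); rewrite /trunc /= => ->.
suff -> : glue 3 (scons t (scons (thead x) (fun _ => y))) d =
  foldr (@scons _) d (t :: rcons [tuple thead x] y) by [].
apply: functional_extensionality => -[|[|[|i]]] //.
by rewrite /glue /= !subSS subn0.
Qed.

(* [tv true theta t e] and [tv false theta t e]: the string t already forces
   theta to be true, or false, the set variable i being read through the name
   [N i] of a characteristic function. *)
Fixpoint tv (N : nat -> relation M 1) (b : bool) (theta : formula) (t : num M)
    (e : nat -> num M) : Prop :=
  match theta with
  | Eq u v => if b then eval e u = eval e v else eval e u <> eval e v
  | Lt u v => if b then eval e u < eval e v else ~ eval e u < eval e v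
  | In u i => if b then N i t [tuple eval e u] 1
              else exists y, y <> 1 /\ N i t [tuple eval e u] y
  | Not p => tv N (~~ b) p t e
  | And p q => if b then tv N true p t e /\ tv N true q t e
               else tv N false p t e \/ tv N false q t e
  | Or p q => if b then tv N true p t e \/ tv N true q t e
              else tv N false p t e /\ tv N false q t e
  | Imp p q => if b then tv N false p t e \/ tv N true q t e
               else tv N true p t e /\ tv N false q t e
  | BAll u p => if b then forall x, x < eval e u -> tv N true p t (scons x e)
                else exists x, x < eval e u /\ tv N false p t (scons x e)
  | BEx u p => if b then exists x, x < eval e u /\ tv N true p t (scons x e)
               else forall x, x < eval e u -> tv N false p t (scons x e)
  | All _ | Ex _ | SAll _ | SEx _ => False
  end.

Lemma eval_extension e t : @eval (generic_extension GG) e t = @eval M e t.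
Proof. by elim: t => //= [t -> u ->|t -> u ->]. Qed.

Section Truth.
Context (N : nat -> relation M 1) (E : nat -> num M -> Prop).
Context (N_name : forall i, partial_name (N i)) (N_local : forall i, G_local GG (N i)).
Context (N_true : forall i t n, initial_segment t G -> N i t [tuple n] 1 -> E i n).
Context (N_false : forall i t n y, initial_segment t G -> N i t [tuple n] y -> y <> 1 -> ~ E i n).

Lemma tv_s1 (b : bool) theta (s : nat -> (nat -> num M) -> num M) u : Delta00 theta ->
  (forall i, isTm (s i)) -> isTm u -> isS1 (fun e => tv N b theta (u e) (fun i => s i e)).
Proof.
elim: theta b s u => //=
  [t v|t v|t i|p IHp|p IHp q IHq|p IHp q IHq|p IHp q IHq|t p IHp|t p IHp] b s u.
- move=> _ hs hu; have h1 := tm_eval t hs; have h2 := tm_eval v hs.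
  by case: b; apply: s1_f; [|apply: f_not]; apply: f_eq.
- move=> _ hs hu; have h1 := tm_eval t hs; have h2 := tm_eval v hs.
  by case: b; apply: s1_f; [|apply: f_not]; apply: f_lt.
- move=> _ hs hu; have h1 := tm_eval t hs; have [hN _ _ _] := N_name i.
  case: b; first by apply: relation_s1 => //; apply: tm_const.
  apply: s1_ex; apply: s1_and; first by def.
  by apply: (relation_s1 hN); [apply: tm_ren | apply: (tm_ren _ h1) | apply: tm_var].
- by move=> hp hs hu; apply: IHp.
- by move=> [hp hq] hs hu; case: b; [apply: s1_and | apply: s1_or]; auto.
- by move=> [hp hq] hs hu; case: b; [apply: s1_or | apply: s1_and]; auto.
- by move=> [hp hq] hs hu; case: b; [apply: s1_or | apply: s1_and]; auto.
- move=> hp hs hu; have h1 := tm_eval t hs.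
  have h2 (c : bool) : isS1 (fun e => tv N c p (u (fun i => e i.+1)) (scons (e 0%N) (fun i => s i (fun j => e j.+1)))).
    apply: s1_iff (IHp c _ _ hp (tm_lift hs) (tm_ren S hu)) => e.
    by rewrite lift_tmE.
  case: b; first by apply: s1_ball.
  apply: s1_ex; apply: s1_and; last exact: h2.
  by apply: s1_f; apply: f_lt; [apply: tm_var | apply: (tm_ren S h1)].
- move=> hp hs hu; have h1 := tm_eval t hs.
  have h2 (c : bool) : isS1 (fun e => tv N c p (u (fun i => e i.+1)) (scons (e 0%N) (fun i => s i (fun j => e j.+1)))).
    apply: s1_iff (IHp c _ _ hp (tm_lift hs) (tm_ren S hu)) => e.
    by rewrite lift_tmE.
  case: b; last by apply: s1_ball.
  apply: s1_ex; apply: s1_and; last exact: h2.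
  by apply: s1_f; apply: f_lt; [apply: tm_var | apply: (tm_ren S h1)].
Qed.

Lemma tv_monotone (b : bool) theta e : monotone (fun t => tv N b theta t e).
Proof.
move=> t t' + htt'; elim: theta b e => //=
  [u i|p IHp|p IHp q IHq|p IHp q IHq|p IHp q IHq|u p IHp|u p IHp] b e.
- have [_ _ hmon _] := N_name i; case: b => [h|[y [hy h]]]; first exact: hmon htt'.
  by exists y; split=> //; apply: hmon htt'.
- exact: IHp.
- by case: b => -[]; [split | left | right]; auto.
- by case: b => -[]; [left | right | split]; auto.
- by case: b => -[]; [left | right | split]; auto.
- case: b => [h x /h|[x [hx h]]]; first exact: IHp.
  by exists x; split=> //; apply: IHp.
- case: b => [[x [hx h]]|h x /h]; last exact: IHp.
  by exists x; split=> //; apply: IHp.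
Qed.

Lemma tv_sound theta (b : bool) t e : Delta00 theta -> initial_segment t G -> tv N b theta t e ->
  if b then @sat (generic_extension GG) e E theta else ~ @sat (generic_extension GG) e E theta.
Proof.
move=> + ht; elim: theta b e => //=
  [u v|u v|u i|p IHp|p IHp q IHq|p IHp q IHq|p IHp q IHq|u p IHp|u p IHp] b e;
  rewrite ?eval_extension.
- by case: b.
- by case: b.
- move=> _; case: b => [|[y [hy h]]]; first exact: N_true.
  exact: N_false ht h hy.
- by move=> hp; case: b => /= /(IHp _ _ hp) //= h h'; apply: h'.
- move=> [hp hq]; case: b => [[/(IHp _ _ hp) ? /(IHq _ _ hq)]//|[/(IHp _ _ hp)|/(IHq _ _ hq)] h []//].
- move=> [hp hq]; case: b => [[/(IHp _ _ hp)|/(IHq _ _ hq)]|[/(IHp _ _ hp) h /(IHq _ _ hq) h'] []//]; by [left | right].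
- move=> [hp hq]; case: b => [[/(IHp _ _ hp)|/(IHq _ _ hq)] //|[/(IHp _ _ hp) h /(IHq _ _ hq) h'] hi].
  exact: h' (hi h).
- move=> hp; case: b => [h x hx|[x [hx /(IHp _ _ hp) h]] h']; first exact: (IHp true _ hp (h x hx)).
  exact: h (h' x hx).
- move=> hp; case: b => [[x [hx /(IHp _ _ hp) h]]|h [x [hx h']]]; first by exists x.
  exact: (IHp false _ hp (h x hx)) h'.
Qed.

Definition decided theta e t := tv N true theta t e \/ tv N false theta t e.

Lemma decided_monotone theta e : monotone (decided theta e).
Proof. by move=> t t' [h|h] htt'; [left | right]; apply: (tv_monotone h htt'). Qed.

(** Only finitely many names occur in theta, in the sense of the metatheory, so conditions making
    them local have a common extension in the filter. *)
Lemma decided_dense theta : Delta00 theta ->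
  exists p, GG p /\ forall e, dense_below p (decided theta e).
Proof.
have [p0 hp0] : exists p, GG p by have [[_ [p hp] _ _] _] := hG; exists p.
have common P Q : (exists p, GG p /\ forall e, dense_below p (decided P e)) ->
    (exists p, GG p /\ forall e, dense_below p (decided Q e)) ->
    exists p, GG p /\ forall e, dense_below p (fun t => decided P e t /\ decided Q e t).
  move=> [p [hp hdp]] [q [hq hdq]]; have [r [hr hrp hrq]] := generic_common hp hq.
  exists r; split=> // e.
  apply: dense_and; try exact: decided_monotone.
    exact: dense_weak hrp (hdp e).
  exact: dense_weak hrq (hdq e).
(* A single condition deals with every value of the bound variable, so the instances can be combined
   by [dense_ball]. *)
have ball P u : Delta00 P -> (exists p, GG p /\ forall e, dense_below p (decided P e)) ->
    exists p, GG p /\ forall e, dense_below p (fun t => forall x, x < eval e u -> decided P (scons x e) t).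
  move=> hP [p [hp hd]]; exists p; split=> // e.
  apply: (@dense_ball p (fun x => decided P (scons x e)) (eval e u)) => [|x|x _]; last exact: hd.
    have hs i : isTm (scons (fun e' => e' 0%N) (fun j (_ : nat -> num M) => e j) i).
      by case: i => [|i]; [apply: tm_var | apply: tm_const].
    have h (b : bool) : isS1 (fun e' => tv N b P (e' 1%N) (scons (e' 0%N) e)).
      apply: s1_iff (tv_s1 b hP hs (tm_var 1)) => e'.
      by apply: iff_of_eq; congr tv; apply: functional_extensionality; case.
    exact: s1_or (h true) (h false).
  exact: decided_monotone.
elim: theta => //= [u v|u v|u i|p IHp|p IHp q IHq|p IHp q IHq|p IHp q IHq|u p IHp|u p IHp].
- move=> _; exists p0; split=> // e; apply: dense_true => t.
  by rewrite /decided /=; apply: classic.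
- move=> _; exists p0; split=> // e; apply: dense_true => t.
  by rewrite /decided /=; apply: classic.
- move=> _; have [p [hp hloc]] := N_local i; exists p; split=> // e.
  apply: dense_imp (local_dense (eval e u) (generic_condition hp) hloc) => t _ [y hy].
  rewrite /decided /=; case: (classic (y = 1)) => [h1|h1]; first by left; rewrite -h1.
  by right; exists y.
- move=> /IHp [r [hr hd]]; exists r; split=> // e; apply: dense_imp (hd e) => t _.
  by rewrite /decided /= => -[]; [right | left].
- move=> [/IHp hp /IHq hq]; have [r [hr hd]] := common _ _ hp hq; exists r; split=> // e.
  apply: dense_imp (hd e) => t _; rewrite /decided /=; tauto.
- move=> [/IHp hp /IHq hq]; have [r [hr hd]] := common _ _ hp hq; exists r; split=> // e.
  apply: dense_imp (hd e) => t _; rewrite /decided /=; tauto.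
- move=> [/IHp hp /IHq hq]; have [r [hr hd]] := common _ _ hp hq; exists r; split=> // e.
  apply: dense_imp (hd e) => t _; rewrite /decided /=; tauto.
- move=> hp; have [r [hr hd]] := ball _ u hp (IHp hp); exists r; split=> // e.
  apply: dense_imp (hd e) => t _ h; rewrite /decided /=.
  case: (classic (exists x, x < eval e u /\ tv N false p t (scons x e))) => h'; first by right.
  by left=> x hx; case: (h x hx) => // hf; case: h'; exists x.
- move=> hp; have [r [hr hd]] := ball _ u hp (IHp hp); exists r; split=> // e.
  apply: dense_imp (hd e) => t _ h; rewrite /decided /=.
  case: (classic (exists x, x < eval e u /\ tv N true p t (scons x e))) => h'; first by left.
  by right=> x hx; case: (h x hx) => // hf; case: h'; exists x.
Qed.

Lemma sigma_truth phi e : Sigma01 phi -> exists W : num M -> num M -> Prop,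
  [/\ isS1 (fun e => W (e 0%N) (e 1%N)), forall n, monotone (W n)
    & forall n, @sat (generic_extension GG) (scons n e) E phi <->
                exists t, initial_segment t G /\ W n t].
Proof.
move=> [theta hth ->]; exists (fun n t => exists x, tv N true theta t (scons x (scons n e))).
have hW : isS1 (fun e' => exists x, tv N true theta (e' 1%N) (scons x (scons (e' 0%N) e))).
  apply: s1_ex.
  pose s := scons (fun e' => e' 0%N) (scons (fun e' => e' 1%N) (fun j (_ : nat -> num M) => e j)).
  have hs i : isTm (s i) by case: i => [|[|i]]; [apply: tm_var | apply: tm_var | apply: tm_const].
  apply: s1_iff (tv_s1 true hth hs (tm_var 2)) => e'.
  by apply: iff_of_eq; congr tv; apply: functional_extensionality => -[|[|]].
split=> // [n t t' [x hx] htt'|n]; first by exists x; apply: (tv_monotone hx htt').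
split=> /= [[x hx]|[t [ht [x hx]]]]; last by exists x; apply: (tv_sound hth ht hx).
(* G has an initial segment deciding theta at the witness x, and soundness excludes the verdict
   false. *)
have [p [hp hd]] := decided_dense hth.
have [|t [ht [h|h]]] := dense_generic _ hp (hd (scons x (scons n e))).
- have hs i : isTm (fun _ => scons x (scons n e) i) by apply: tm_const.
  by move=> t ht; apply: f_s1; apply: s1_or; apply: (tv_s1 _ hth hs ht).
- by exists t; split=> //; exists x.
- by case: (tv_sound hth ht h).
Qed.

End Truth.

Lemma set_name X : @sets (generic_extension GG) X -> exists F : relation M 1,
  [/\ partial_name F, G_local GG F,
      forall t n, initial_segment t G -> F t [tuple n] 1 -> X n
    & forall t n y, initial_segment t G -> F t [tuple n] y -> y <> 1 -> ~ X n].
Proof.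
move=> [f [[F [hF hloc hf]] hX]].
have val t n y : initial_segment t G -> F t [tuple n] y -> f [tuple n] = y.
  by move=> [l ht] h; apply/hf; exists l, t.
exists F; split=> // t n.
  move=> ht /(val _ _ _ ht) h1; apply: NNPP => /(proj2 (hX n)); rewrite h1; exact: one_neq0.
by move=> y ht /(val _ _ _ ht) <- hy /(proj1 (hX n)).
Qed.

Lemma extension_truth phi e E : Sigma01 phi -> @set_env (generic_extension GG) E ->
  exists W : num M -> num M -> Prop,
  [/\ isS1 (fun e => W (e 0%N) (e 1%N)), forall n, monotone (W n)
    & forall n, @sat (generic_extension GG) (scons n e) E phi <->
                exists t, initial_segment t G /\ W n t].
Proof.
move=> hphi hE.
pose N i := proj1_sig (constructive_indefinite_description _ (set_name (hE i))).
have hN i := proj2_sig (constructive_indefinite_description _ (set_name (hE i))).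
by apply: (@sigma_truth N E) => // i; have [] := hN i.
Qed.

(** * The axioms of the generic extension *)

Lemma extension_induction : Sigma01_induction (generic_extension GG).
Proof.
move=> phi e E hphi hE h0 hS n.
have [W [hW hmon hWE]] := extension_truth e hphi hE.
have hW2 := s1_subst2 hW.
pose k : num M := n + 1.
pose P a A (_ : num M -> Prop) := forall i, i < k ->
  (exists t, decides a A t /\ W i t) \/ (forall t, compat a A t -> ~ W i t).
have [||p [hp hP]] := @generic_meets P.
- by rewrite /P; def.
- move=> p hp; have [ha sA haA _ _] := hp.
  have [m [m0 hm]] : exists m, m <> 0 /\ forall i, i < k -> dvd (i + 1) m.
    by apply: common_multiple => [t ht|i]; [def | apply: succ_neq0].
  have [s0 hs0] := compat_stem 0 haA.
  have [|t [d [ht h1 h2]]] := @maximize (compat (stem p) (reservoir p)) W k m _ _ hW m0 hm hs0.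
    by def.
  have [l [s [tE hs hsl has]]] := ht; rewrite tE in ht h1 h2.
  have [q [hq hqp hd hext]] := restrict_decides hp ht.
  exists q; do 2!split=> //; move=> i hi.
  case: (classic (W i (pair l s))) => hWi; [by left; exists (pair l s) | right=> t' ht' hWt'].
  (* As t misses W_i, the i-th modulus divides d. The string t'' extends t, so it meets whatever t
     meets, and W_i as well, against maximality. *)
  case: (h1 i hi) => // hdvd.
  have [t'' [ht'' hext1 hext2]] := hext t' ht'.
  apply: (h2 t'' ht'' _ i hi) => //; last exact: hmon hWt' hext2.
  by move=> j hj hWj; apply: hmon hWj hext1.
have decE i : i < k -> (exists t, decides (stem p) (reservoir p) t /\ W i t) <->
    @sat (generic_extension GG) (scons i e) E phi.
  move=> hi; rewrite hWE; split=> [[t [ht hWt]]|[t [ht hWt]]].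
    by exists t; split=> //; apply: generic_decides ht.
  by case: (hP i hi) => // h; case: (h t) => //; apply: generic_compat.
have sA : sets (reservoir p) by case: (generic_condition hp).
(* Below k, truth of phi is now a Sigma^0_1 predicate of the ground model; the first disjunct lets
   the induction run past k. *)
suff h i : ~ i < k \/ exists t, decides (stem p) (reservoir p) t /\ W i t.
  by apply/decE; [apply: ltnSn | case: (h n) => // -[]; apply: ltnSn].
move: i; apply: s1_ind => [||i hi]; first by def.
  by case: (classic (0 < k)) => hk; [right; apply/decE | left].
case: (classic (i + 1 < k)) => hk; [right | by left].
have hik : i < k by apply: lt_trans (ltnSn i) hk.
by apply/decE => //; apply: hS; apply/decE => //; case: hi.
Qed.

Lemma prefix_total (u v t : num M) : string_ext u t -> string_ext v t -> string_ext u v \/ string_ext v u.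
Proof.
move=> [hu [_ [l [s [l1 [s1 [uE [tE [hl h]]]]]]]]] [hv [_ [l' [s' [l2 [s2 [vE [tE' [hl' h']]]]]]]]].
move: tE' h' hl'; rewrite tE => /pair_inj [<- <-] h' hl'.
rewrite uE vE in hu hv *.
case: (leq_total l l') => hll; [left | right]; apply/string_extE; split=> // i hi.
  by rewrite h // h' //; apply: lt_leq_trans hll.
by rewrite h' // h //; apply: lt_leq_trans hll.
Qed.

Lemma segment_prefix u t X : string_ext u t -> initial_segment t X -> initial_segment u X.
Proof.
move=> [[l [s [uE [hs hsl]]]] [_ [l1 [s1 [l' [s' [uE' [tE [hl h]]]]]]]]] [l2 [s2 [tE' [_ hX]]]].
move: uE' tE' h hX hl; rewrite uE tE => /pair_inj [<- <-] /pair_inj [<- <-] h hX hl.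
exists l, s; split=> //; split=> // i; split=> [hi|[hXi hi]].
  by have hil := hsl i hi; split=> //; have /hX [] : mem i s' by apply/h.
by apply/h => //; apply/hX; split=> //; apply: lt_leq_trans hl.
Qed.

(* Below a condition p of the filter no compatible string witnesses both sides;
   reading a string t through its prefixes compatible with p makes the name
   single-valued on all strings. *)
Lemma extension_comprehension : Delta01_comprehension (generic_extension GG).
Proof.
move=> phi psi e E hphi [theta hth ->] hE heq.
have [W1 [hW1 mon1 W1E]] := extension_truth e hphi hE.
(* The negation of the Pi^0_1 side is again Sigma^0_1, so W0 witnesses failure of phi as W1
   witnesses its truth. *)
have [||W0 [hW0 mon0 W0E]] := @extension_truth (Ex (Not theta)) e E => //; first by exists (Not theta).
pose phiG n := @sat (generic_extension GG) (scons n e) E phi.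
have {}W0E n : ~ phiG n <-> exists t, initial_segment t G /\ W0 n t.
  rewrite -W0E /phiG heq /=; split=> [h|[x hx] h]; last exact: hx (h x).
  by apply: NNPP => h'; apply: h => x; apply: NNPP => hx; apply: h'; exists x.
have hW1' := s1_subst2 hW1; have hW0' := s1_subst2 hW0.
(* A condition in the filter decides whether some string witnesses both sides. The positive case
   would put such a string into G, making phi both true and false. *)
have [|p1 [hp1 [[t [/(generic_decides hp1) ht [n [h1 h0]]]]|hno]]] :=
    @generic_decision (fun t => exists n, W1 n t /\ W0 n t).
- by move=> t ht; def.
- have h1' : phiG n by apply/W1E; exists t.
  by have /W0E : exists t, initial_segment t G /\ W0 n t by exists t.
have [||p2 [hp2 hd]] := @generic_family (fun n t => W1 n t \/ W0 n t).
- by def.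
- move=> n; case: (classic (phiG n)) => [/W1E|/W0E] [t [ht h]]; exists t; split=> //; by [left | right].
have [p [hp hpp1 hpp2]] := generic_common hp1 hp2.
have [_ sA _ _ _] := generic_condition hp.
pose F : relation M 1 := fun t xs y => exists u, string_ext u t /\
  (compat (stem p) (reservoir p) u /\ ((y = 1 /\ W1 (thead xs) u) \/ (y = 0 /\ W0 (thead xs) u))).
have F_s1 (u v w : (nat -> num M) -> num M) :
    isTm u -> isTm v -> isTm w -> isS1 (fun e => F (u e) [tuple v e] (w e)).
  by move=> hu hv hw; rewrite /F; def.
have F_name : partial_name F.
  split.
  - by apply: s1_relation; apply: F_s1; apply: tm_var.
  - by move=> t x y [u [[_ [h _]] _]].
  - move=> t t' x y [u [hut hu]] htt'; exists u; split=> //; exact: string_ext_trans htt'.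
  move=> t x y y' [u [hut [hu hy]]] [u' [hut' [hu' hy']]].
  have conflict v : compat (stem p) (reservoir p) v -> W1 (thead x) v -> W0 (thead x) v -> False.
    move=> hv h1 h0; have [? _ ? _] := hpp1; apply: (hno v); last by exists (thead x).
    exact: compat_sub hv.
  (* Two prefixes of one string are comparable; by monotonicity the longer would witness both
     sides. *)
  case: hy hy' => [[-> h1]|[-> h0]] [[-> h1']|[-> h0']] //; exfalso;
    case: (prefix_total hut hut') => hext.
  - exact: conflict hu' (mon1 _ _ _ h1 hext) h0'.
  - exact: conflict hu h1 (mon0 _ _ _ h0' hext).
  - exact: conflict hu' h1' (mon0 _ _ _ h0 hext).
  - exact: conflict hu (mon1 _ _ _ h1' hext) h0.
have F_value t xs y : initial_segment t G -> F t xs y ->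
    (phiG (thead xs) /\ y = 1) \/ (~ phiG (thead xs) /\ y = 0).
  move=> ht [u [hut [_ hu]]]; have htu : initial_segment u G by apply: segment_prefix hut ht.
  by case: hu => -[-> h]; [left | right]; split=> //; [apply/W1E | apply/W0E]; exists u.
have F_local : G_local GG F.
  exists p; split=> //; apply: dense_local.
  - exact: generic_condition.
  - by apply: s1_ex; apply: F_s1; apply: tm_var.
  - move=> x t t' [y hy] htt'; exists y; have [_ _ h _] := F_name; exact: h hy htt'.
  move=> x q hq hqp; have [t [ht h]] := hd x q hq (weak_ext_trans hqp hpp2).
  have [? _ ? _] := hqp; have htp := compat_sub _ _ ht.
  exists t; split=> //; case: h => h; [exists 1 | exists 0]; exists t; split.
  + by apply: string_ext_refl; apply: compat_string ht.
  + by split; [apply: htp | left].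
  + by apply: string_ext_refl; apply: compat_string ht.
  + by split; [apply: htp | right].
pose f (x : 1.-tuple (num M)) : num M := if excluded_middle_informative (phiG (thead x)) then 1 else 0.
exists phiG; split=> //; exists f; split; last first.
  by move=> n; rewrite /f theadE; case: excluded_middle_informative.
exists F; split=> // x y; rewrite /f; split=> [<-|].
  have seg_F t z : initial_segment t G -> (z = 1 /\ W1 (thead x) t) \/ (z = 0 /\ W0 (thead x) t) ->
      eval_name GG F x z.
    move=> ht h; have [l hl] := ht; exists l, t; split=> //; exists t; split; last first.
      by split=> //; apply: generic_compat.
    by apply: string_ext_refl; apply: segment_string ht.
  case: excluded_middle_informative => hn.
    by have [t [ht h]] := proj1 (W1E _) hn; apply: (seg_F t) => //; left.
  by have [t [ht h]] := proj1 (W0E _) hn; apply: (seg_F t) => //; right.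
move=> [l [t [ht h]]].
have [|[h1 ->]|[h1 ->]] := F_value t x y _ h; first by exists l.
  by case: excluded_middle_informative.
by case: excluded_middle_informative.
Qed.

End Structure.

Theorem proposition8 (M : L2structure) (hWKL : WKL0 M) (hB : BSigma02 M)
    (GG : triple M -> Prop) (hG : generic_filter GG) :
  RCA0 (generic_extension GG).
Proof.
(* The reservoir of a condition in the filter is the set of the model on which the definability
   lemmas rely. *)
have [[cond [p hp] _ _] _] := hG; have [_ sX _ _ _] := cond p hp.
have [hM _] := hWKL; split.
- by have [] := hM.
- exact (extension_induction sX hM hG).
- exact (extension_comprehension sX hM hG).
Qed.
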